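(* Let $\mathcal H$ be an $(\alpha,c,D,\nu,\delta)$-family of functions $h:\mathbb{N}^k\to[0,\infty)$ and let $j\in\mathbb{N}_0$. Then there exists $\eta>0$ such that for every $h\in\mathcal H$ there is a real polynomial $p_{h,j}$ of degree at most $k+j$ with $$\sum_{\substack{\mathbf{x}\in\mathbb{N}^k\\ x_i\le X\ (1\le i\le k)}}\frac{(\log\langle\mathbf{x}\rangle)^j}{\langle\mathbf{x}\rangle^\alpha}h(\mathbf{x})=p_{h,j}(\log X)+O(X^{-\eta}),$$ the implied constant being independent of $h\in\mathcal H$ and $X>1$. If $c_h\ne0$, then $p_{h,j}$ has degree exactly $k+j$ and leading coefficient $\alpha^kc_hV_{k,j}$, where $V_{k,j}=\int_{[0,1]^k}(\xi_1+\cdots+\xi_k)^j\,d\boldsymbol\xi$.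
   Context: Notation: for $\mathbf{x},\mathbf{X}\in\mathbb{R}^k$, $\mathbf{x}\le\mathbf{X}$ means $x_j\le X_j$ for all $j$; for $\mathbf{X}$ with all $X_j\ge1$, $\langle\mathbf{X}\rangle=X_1\cdots X_k$; $|\mathbf{u}|=\max_j|u_j|$; for $\mathbf{u}\in\mathbb{N}^r$, $\mathbf{v}\in\mathbb{N}^{k-r}$, $(\mathbf{u},\mathbf{v})\in\mathbb{N}^k$ is the concatenation; for $\sigma\in S_k$, $h_\sigma(\mathbf{x})=h(x_{\sigma(1)},\ldots,x_{\sigma(k)})$. Let $\alpha,c,\delta>0$ with $\delta<\min(1,\alpha)$, $0<\nu\le1$, $D\ge0$. A set $\mathcal H$ of functions $h:\mathbb{N}^k\to[0,\infty)$ is an $(\alpha,c,D,\nu,\delta)$-family if: (I) for each $h\in\mathcal H$ there is $c_h\in[0,c]$ with $\sum_{\mathbf{x}\le\mathbf{X}}h(\mathbf{x})=c_h\langle\mathbf{X}\rangle^\alpha+O(\langle\mathbf{X}\rangle^\alpha(\min_jX_j)^{-\delta})$ uniformly in $h\in\mathcal H$ and $\mathbf{X}\in[1,\infty)^k$; (II) for each $h\in\mathcal H$ and each $1\le r\le k-1$ there is $c_{h,r}:\mathbb{N}^r\to[0,\infty)$ with $\sum_{\mathbf{v}\le\mathbf{V}}h(\mathbf{u},\mathbf{v})=c_{h,r}(\mathbf{u})\langle\mathbf{V}\rangle^\alpha+O(\langle\mathbf{V}\rangle^\alpha|\mathbf{u}|^D(\min_jV_j)^{-\delta})$ uniformly in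 $h\in\mathcal H$, $\mathbf{V}\in[1,\infty)^{k-r}$ and $\mathbf{u}\in\mathbb{N}^r$ with $|\mathbf{u}|\le\langle\mathbf{V}\rangle^\nu$; (III) $h_\sigma\in\mathcal H$ for all $h\in\mathcal H$, $\sigma\in S_k$. *)

(* Defs.v *)
From HB Require Import structures.
From mathcomp Require Import all_boot all_order all_algebra.
From mathcomp Require Import perm.
From mathcomp Require Import all_classical all_reals all_analysis.

Set Implicit Arguments.
Unset Strict Implicit.
Unset Printing Implicit Defensive.

Import Order.TTheory GRing.Theory Num.Theory.
Import numFieldNormedType.Exports.

Local Open Scope classical_set_scope.
Local Open Scope ring_scope.

(* In this file N is the set of positive integers. *)
Notation posint := {n : nat | (0 < n)%N}.

Section vectors.
Context {R : realType}.
Implicit Types k r s : nat.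

Definition toR k (x : k.-tuple posint) : k.-tuple R :=
  [tuple (val (tnth x i))%:R | i < k].

Definition vle k (x y : k.-tuple R) : Prop :=
  forall i, tnth x i <= tnth y i.

(* <X> *)
Definition vprod k (X : k.-tuple R) : R := \prod_(i < k) tnth X i.

(* min_i X_i; the fold starts at the first coordinate, so for 0 < k it is the
   true minimum (the default value 1 only occurs for k = 0). *)
Definition vmin k (X : k.-tuple R) : R :=
  \big[Num.min/head 1 X]_(i < k) tnth X i.

Definition vmax k (u : k.-tuple posint) : nat := \max_(i < k) val (tnth u i).

(* This set is finite, so that the sums \sum_(x \in box X) below (which are 0
   by convention over an infinite support) are the intended ones. *)
Definition box k (X : k.-tuple R) : set (k.-tuple posint) :=
  [set x | vle (toR x) X].

Definition vconcat k r s (e : (r + s)%N = k)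
    (u : r.-tuple posint) (v : s.-tuple posint) : k.-tuple posint :=
  tcast e [tuple of u ++ v].

Definition permute k (sigma : 'S_k) (h : k.-tuple posint -> R) :
    k.-tuple posint -> R :=
  fun x => h [tuple tnth x (sigma i) | i < k].

End vectors.

Section family.
Context {R : realType} {k : nat}.
Variables (alpha c D nu delta : R) (H : set (k.-tuple posint -> R)).

(* cH h is the constant c_h; for 0 < k it is determined by h. *)
Definition family_I (cH : (k.-tuple posint -> R) -> R) : Prop :=
  (forall h, H h -> 0 <= cH h <= c) /\
  exists C : R, forall h, H h ->
    forall X : k.-tuple R, (forall i, 1 <= tnth X i) ->
      `| \sum_(x \in box X) h x - cH h * vprod X `^ alpha |
        <= C * (vprod X `^ alpha * vmin X `^ (- delta)).

(* r ranges over 1 <= r <= k - 1, and s is k - r; cHr h is c_{h,r}. *)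
Definition family_II : Prop :=
  forall r s (e : (r + s)%N = k), (0 < r)%N -> (0 < s)%N ->
  exists cHr : (k.-tuple posint -> R) -> r.-tuple posint -> R,
    (forall h u, H h -> 0 <= cHr h u) /\
    exists C : R, forall h, H h ->
      forall V : s.-tuple R, (forall i, 1 <= tnth V i) ->
      forall u : r.-tuple posint, (vmax u)%:R <= vprod V `^ nu ->
        `| \sum_(v \in box V) h (vconcat e u v) - cHr h u * vprod V `^ alpha |
          <= C * (vprod V `^ alpha * (vmax u)%:R `^ D * vmin V `^ (- delta)).

Definition family_III : Prop :=
  forall h (sigma : 'S_k), H h -> H (permute sigma h).

(* H is an (alpha, c, D, nu, delta)-family of functions N^k -> [0, +oo[, whose
   constants c_h are the cH h. *)
Record is_family (cH : (k.-tuple posint -> R) -> R) : Prop := IsFamily {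
  fam_alpha_gt0 : 0 < alpha;
  fam_c_gt0 : 0 < c;
  fam_delta_gt0 : 0 < delta;
  fam_delta_lt : delta < Num.min 1 alpha;
  fam_nu : 0 < nu <= 1;
  fam_D_ge0 : 0 <= D;
  fam_ge0 : forall h x, H h -> 0 <= h x;
  fam_I : family_I cH;
  fam_II : family_II;
  fam_III : family_III }.

End family.

Section tuple_measure.
Local Open Scope ereal_scope.
Context d (T : measurableType d) (R : realType) (n : nat).
Variables (m1 : {sigma_finite_measure set T -> \bar R})
          (m2 : {sigma_finite_measure set (n.-tuple T) -> \bar R}).

Definition cons_pair (p : T * n.-tuple T) : n.+1.-tuple T :=
  [tuple of p.1 :: p.2].

Lemma measurable_cons_pair :
  measurable_fun [set: T * n.-tuple T] cons_pair.
Proof. exact: measurable_cons. Qed.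

Definition cons_measure : set (n.+1.-tuple T) -> \bar R :=
  pushforward (m1 \x m2) cons_pair.

Let cons_measure0 : cons_measure set0 = 0.
Proof. by rewrite /cons_measure /pushforward preimage_set0 measure0. Qed.

Let cons_measure_ge0 A : 0 <= cons_measure A.
Proof. by rewrite /cons_measure /pushforward; exact: measure_ge0. Qed.

Let cons_measure_sigma_additive : semi_sigma_additive cons_measure.
Proof.
move=> F mF tF mUF; rewrite /cons_measure /pushforward preimage_bigcup.
have mpre A : measurable A -> measurable (cons_pair @^-1` A).
  by move=> mA; rewrite -[X in measurable X]setTI; exact: measurable_cons_pair.
apply: measure_semi_sigma_additive.
- by move=> i; exact: mpre.
- apply/trivIsetP => /= i j _ _ ij; rewrite -preimage_setI.
  by move/trivIsetP : tF => /(_ _ _ _ _ ij) ->//; rewrite preimage_set0.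
- by rewrite -preimage_bigcup; exact: mpre.
Qed.

HB.instance Definition _ := isMeasure.Build _ _ _ cons_measure
  cons_measure0 cons_measure_ge0 cons_measure_sigma_additive.

Let cons_measure_sigma_finite : sigma_finite setT cons_measure.
Proof.
have /sigma_finiteP[F [UF ndF Ffin]] := sigma_finiteT m1.
have /sigma_finiteP[G [UG ndG Gfin]] := sigma_finiteT m2.
pose tl (t : n.+1.-tuple T) : n.-tuple T := [tuple of behead t].
exists (fun i => [set t | F i (thead t) /\ G i (tl t)]).
  apply/esym; rewrite -subTset => t _.
  have [i _ Fi] : (\bigcup_i F i) (thead t) by rewrite -UF.
  have [j _ Gj] : (\bigcup_j G j) (tl t) by rewrite -UG.
  exists (maxn i j) => //; split.
    by move: Fi; exact/subsetPset/ndF/leq_maxl.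
  by move: Gj; exact/subsetPset/ndG/leq_maxr.
move=> i; have [mF Foo] := Ffin i; have [mG Goo] := Gfin i; split.
  apply: measurableI; rewrite -[X in measurable X]setTI.
    exact: measurable_tnth.
  exact: measurable_behead.
rewrite /cons_measure /pushforward [X in (_ \x _) X](_ : _ = F i `*` G i).
  by rewrite product_measure1E// lte_mul_pinfty// ge0_fin_numE.
have tlE p : tl (cons_pair p) = p.2 by exact/val_inj.
by apply/seteqP; split => p /=; rewrite tlE.
Qed.

HB.instance Definition _ := Measure_isSigmaFinite.Build _ _ _ cons_measure
  cons_measure_sigma_finite.

End tuple_measure.

Section cube.
Context {R : realType}.

(* Lebesgue measure on R^n, as the n-fold product of the one on R *)
Fixpoint lebesgue_tuple (n : nat) :
    {sigma_finite_measure set (n.-tuple (measurableTypeR R)) -> \bar R} :=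
  if n is n'.+1 then cons_measure (@lebesgue_measure R) (lebesgue_tuple n')
  else \d_ [tuple].

Definition unit_cube (n : nat) : set (n.-tuple (measurableTypeR R)) :=
  [set t | forall i, (0 : R) <= tnth t i <= 1].
Arguments unit_cube : clear implicits.

Definition V_ (k j : nat) : R :=
  \int[lebesgue_tuple k]_(t in unit_cube k) (\sum_(i < k) tnth t i) ^+ j.

End cube.

Arguments unit_cube {R} n.

Definition log_sum (R : realType) (k : nat) (alpha : R) (j : nat)
    (h : k.-tuple posint -> R) (X : R) : R :=
  \sum_(x \in box [tuple X | _ < k])
    (ln (vprod (toR x)) ^+ j / vprod (toR x) `^ alpha * h x).

(* Main.v *)
(* Let F(X) be the sum of h over the box x <= X and f(X) = F(X) / <X>^alpha.
   By (I)-(III), f hardly changes when a block of coordinates that are much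
   larger than the remaining ones is moved, so for every set K of coordinates f
   has a limit f_K as the coordinates outside K go to infinity, and f_K = c_h for empty K.
   Moebius inversion over the subsets of coordinates gives f = sum_I g_I with
   g_I = sum_(K <= I) (-1)^(|I| + |K|) f_K.  By pigeonhole some scale between 1 and the
   largest coordinate in I separates large from much smaller coordinates;
   the terms of g_I then cancel in pairs up to a power saving in the largest
   coordinate, hence g_I is bounded by a product of negative powers.
   Since (log <x>)^j is a sum of products of powers of the log x_i, Abel summation
   in each variable turns the sum of the theorem into sums of f against products
   of one-variable coefficients.  In the contribution of g_I every variable
   outside I gives alpha (log X)^(b + 1) / (b + 1) + constant + O(X^-1/2), while
   the variables in I give a convergent sum.  Only empty I reaches the degree k + j,
   with leading coefficient alpha^k c_h times the sum of the products of the
   1 / (b_i + 1), which is V_{k,j}. *)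
Require Import Defs.
From HB Require Import structures.
From mathcomp Require Import all_boot all_order all_algebra.
From mathcomp Require Import perm.
From mathcomp Require Import all_classical all_reals all_analysis.
From mathcomp Require Import measurable_realfun ring lra.

Set Implicit Arguments.
Unset Strict Implicit.
Unset Printing Implicit Defensive.

Import Order.TTheory GRing.Theory Num.Theory.
Import numFieldNormedType.Exports.

Local Open Scope classical_set_scope.
Local Open Scope ring_scope.

(** * One-variable estimates *)

Section one_variable.
Context {R : realType}.
Implicit Types (b : nat) (x y a : R).

Lemma powR_expR_ln (x r : R) : 0 < x -> x `^ r = expR (r * ln x).
Proof. by move=> x0; rewrite /powR gt_eqF. Qed.

Lemma powR_sum_exp (x r s : R) : 0 < x -> x `^ (r + s) = x `^ r * x `^ s.
Proof. by move=> x0; rewrite powRD// (gt_eqF x0) implybT. Qed.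

(** A single term of the exponential series at e (1 + ln x) is at most [expR e] times x^e, which
    gives the constant b!/e^b times [expR e]. *)
Lemma ln_pow_bound (b : nat) (e : R) : 0 < e ->
  exists2 C : R, 0 <= C & forall x, 1 <= x -> (1 + ln x) ^+ b <= C * x `^ e.
Proof.
move=> e0; case: b => [|b].
  exists 1 => // x x1; rewrite expr0 mul1r powR_expR_ln ?(lt_le_trans ltr01)//.
  by rewrite -[leLHS]expR0 ler_expR mulr_ge0 ?ln_ge0// ltW.
exists (b.+1`!%:R / e ^+ b.+1 * expR e) => [|x x1].
  by rewrite mulr_ge0 ?expR_ge0// divr_ge0// exprn_ge0// ltW.
have y0 : 0 <= e * (1 + ln x).
  by rewrite mulr_ge0 ?addr_ge0 ?ln_ge0// ltW.
have := expR_ge1Dxn b y0.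
rewrite powR_expR_ln ?(lt_le_trans ltr01)// -(mulrA (_ / _)) -expRD.
rewrite (_ : e + e * ln x = e * (1 + ln x)); last by ring.
set E := expR _ => hE.
have {}hE : (e * (1 + ln x)) ^+ b.+1 / b.+1`!%:R <= E.
  by apply: le_trans hE; rewrite lerDr.
rewrite ler_pdivrMr ?ltr0n ?fact_gt0// exprMn in hE.
rewrite mulrAC ler_pdivlMr ?exprn_gt0//.
by rewrite mulrC (mulrC _ E).
Qed.

(** A discrete form of the fact that -x^(-e) has derivative e x^(-1-e), from ln(n+2) - ln(n+1) >=
    1/(n+2) and exp(y) >= 1 + y. Telescoping it bounds the tails of the series of n^(-1-e). *)
Lemma geometric_increment (n : nat) (e : R) : 0 < e ->
  e * n.+2%:R `^ (- 1 - e) <= n.+1%:R `^ (- e) - n.+2%:R `^ (- e).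
Proof.
move=> e0; rewrite powR_sum_exp// powR_inv1//.
rewrite lerBrDr [n.+1%:R `^ _]powR_expR_ln// [n.+2%:R `^ _]powR_expR_ln//.
have hd : (n.+2%:R : R)^-1 <= ln n.+2%:R - ln n.+1%:R.
  rewrite -[leRHS]opprK lerNr opprB.
  have -> : ln (n.+1%:R : R) - ln n.+2%:R = ln (1 + (- n.+2%:R^-1)).
    rewrite -ln_div ?posrE//; congr ln.
    have -> : (n.+1%:R : R) = n.+2%:R - 1 by rewrite -[n.+2]addn1 natrD addrK.
    by rewrite mulrBl mul1r divff.
  by apply: le_ln1Dx; rewrite ltrN2 invf_lt1// ltr1n.
have -> : - e * ln n.+1%:R = - e * ln n.+2%:R + e * (ln n.+2%:R - ln n.+1%:R) :> R.
  by ring.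
rewrite expRD mulrA -{2}[expR (- e * _)]mul1r -mulrDl mulrC ler_wpM2l ?expR_ge0//.
by rewrite (le_trans _ (expR_ge1Dx _))// addrC lerD2l ler_wpM2l// ltW.
Qed.

Lemma sum_geometric_tail (N M : nat) (e : R) : 0 < e -> (0 < N)%N ->
  \sum_(N <= n < M) n.+1%:R `^ (- 1 - e) <= e^-1 * N%:R `^ (- e).
Proof.
move=> e0 N0; have [MN|NM] := leqP M N.
  by rewrite big_geq// mulr_ge0 ?powR_ge0// invr_ge0 ltW.
rewrite mulrC ler_pdivlMr// mulrC mulr_sumr.
apply: (@le_trans _ _ (\sum_(N <= n < M) (n%:R `^ (- e) - n.+1%:R `^ (- e)))).
  rewrite big_seq [leRHS]big_seq ler_sum// => -[|n].
    by rewrite mem_index_iota leqNgt N0.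
  by move=> _; exact: geometric_increment.
rewrite (telescope_sumr_eq (fun n => - (n%:R `^ (- e)))) ?(ltnW NM)//.
  by rewrite opprK addrC gerBl powR_ge0.
by move=> i _; rewrite opprK addrC.
Qed.

Lemma sum_geometric (M : nat) (e : R) : 0 < e ->
  \sum_(0 <= n < M) n.+1%:R `^ (- 1 - e) <= 1 + e^-1.
Proof.
move=> e0; case: M => [|M].
  by rewrite big_geq// addr_ge0// invr_ge0 ltW.
rewrite big_nat_recl// powR1 lerD2l.
have := @sum_geometric_tail 1 M.+1 _ e0 isT.
by rewrite powR1 mulr1 big_add1.
Qed.

(* The limit is the supremum of the lower bounds [u N - eps N]. *)
Lemma cauchy_rate (u eps : nat -> R) :
  (forall N M, (0 < N <= M)%N -> `|u N - u M| <= eps N) ->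
  exists a, forall N, (0 < N)%N -> `|u N - a| <= eps N.
Proof.
move=> hu.
pose A := [set u M - eps M | M in [set M | (0 < M)%N]].
have hub N : (0 < N)%N -> ubound A (u N + eps N).
  move=> N0 _ [M /= M0 <-]; rewrite lerBlDr.
  have [NM|/ltnW MN] := leqP N M.
    have := hu N M; rewrite N0 NM => /(_ isT).
    have := hu M M; rewrite M0 leqnn subrr normr0 => /(_ isT) ?.
    by rewrite ler_norml; lra.
  have := hu M N; rewrite M0 MN => /(_ isT).
  have := hu N N; rewrite N0 leqnn subrr normr0 => /(_ isT) ?.
  by rewrite ler_norml; lra.
have supA : has_sup A.
  split; first by exists (u 1 - eps 1), 1%N.
  by exists (u 1 + eps 1); exact: hub.
exists (sup A) => N N0.
have : sup A <= u N + eps N by apply: ge_sup; [case: supA|exact: hub].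
have : u N - eps N <= sup A by apply: ub_le_sup; [case: supA|exists N].
by rewrite ler_norml => h1 h2; apply/andP; split; lra.
Qed.

(** The mean value bound with y^(b-1) enlarged to (1 + y)^b, which is monotone in b even for y < 1,
    so that one power serves all terms of a polynomial. *)
Lemma exprB_le b x y : 0 <= x -> x <= y ->
  y ^+ b - x ^+ b <= b%:R * (1 + y) ^+ b * (y - x).
Proof.
move=> x0 xy; have y0 := le_trans x0 xy.
elim: b => [|b IH]; first by rewrite !expr0 subrr !mul0r.
have -> : y ^+ b.+1 - x ^+ b.+1 = y * (y ^+ b - x ^+ b) + x ^+ b * (y - x).
  by rewrite !exprS; ring.
rewrite -natr1 mulrDl mul1r mulrDl lerD//.
  rewrite exprS [leRHS](_ : _ = (1 + y) * (b%:R * (1 + y) ^+ b * (y - x))).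
    have h : 0 <= b%:R * (1 + y) ^+ b * (y - x).
      by rewrite mulr_ge0 ?subr_ge0// mulr_ge0// exprn_ge0// addr_ge0.
    by rewrite (le_trans (ler_wpM2l y0 IH))// ler_wpM2r// lerDr.
  by ring.
rewrite ler_wpM2r ?subr_ge0//.
apply: (@le_trans _ _ ((1 + y) ^+ b)).
  by rewrite lerXn2r ?nnegrE ?addr_ge0// (le_trans xy)// lerDr.
by rewrite ler_weXn2l// lerDl.
Qed.

(** Divided by y - x, the difference is a sum of b + 1 products x^i y^(b-i), each of them between
    x^b and y^b. *)
Lemma exprB_bernoulli b x y : 0 <= x -> x <= y ->
  b.+1%:R * x ^+ b * (y - x) <= y ^+ b.+1 - x ^+ b.+1 <= b.+1%:R * y ^+ b * (y - x).
Proof.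
move=> x0 xy; have y0 := le_trans x0 xy; have d0 : 0 <= y - x by rewrite subr_ge0.
rewrite subrXX mulrC [b.+1%:R * _ * _]mulrC.
have e (z : R) : b.+1%:R * z ^+ b = \sum_(i < b.+1) z ^+ b.
  by rewrite sumr_const card_ord mulr_natl.
rewrite !e; apply/andP; split; apply: ler_wpM2l => //;
  apply: ler_sum => i _; rewrite ?subSS /=;
  have ib : (b = b - i + i)%N by rewrite subnK// -ltnS.
- rewrite {1}ib exprD ler_wpM2r ?exprn_ge0//.
  by rewrite lerXn2r ?nnegrE.
- rewrite {4}ib exprD ler_wpM2l ?exprn_ge0//.
  by rewrite lerXn2r ?nnegrE.
Qed.

Lemma expR_quadratic x : 0 <= x -> `|1 - expR (- x) - x| <= x ^+ 2.
Proof.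
move=> x0; have h1 := expR_ge1Dx (- x); have h2 := expR_ge1Dx x.
have h3 : expR (- x) <= 1 - x + x ^+ 2.
  rewrite expRN -[leLHS]mul1r ler_pdivrMr ?expR_gt0//.
  have p : 0 <= 1 - x + x ^+ 2 by nra.
  (* Here (1 - x + x^2)(1 + x) = 1 + x^3 >= 1. *)
  apply: le_trans (ler_wpM2l p h2); nra.
by rewrite ler_norml; apply/andP; split; lra.
Qed.

Lemma ln_succ_sub (n : nat) : (0 < n)%N ->
  0 <= ln (n.+1%:R : R) - ln n%:R <= n%:R^-1.
Proof.
move=> n0; have n0' : (0 : R) < n%:R by rewrite ltr0n.
rewrite -ln_div ?posrE//.
have -> : (n.+1%:R / n%:R : R) = 1 + n%:R^-1.
  by rewrite -natr1 mulrDl mul1r divff ?gt_eqF.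
rewrite ln_ge0 ?lerDl ?invr_ge0 ?ler0n//=.
by apply: le_ln1Dx; rewrite (lt_le_trans (_ : _ < 0))// ?ltrN10// invr_ge0.
Qed.

End one_variable.

(** * Abel summation coefficients in one variable *)

Section weights.
Context {R : realType}.
Variable alpha : R.
Hypothesis alpha_gt0 : 0 < alpha.
Implicit Types (b n N M : nat).

(** Indexed from 0: [n] stands for the integer n + 1. *)
Definition weight b n : R := n.+1%:R `^ (- alpha) * ln n.+1%:R ^+ b.

(* Abel coefficients of the weight truncated to n < N, scaled by (n + 1)^alpha. *)
Definition abel_coef b N n : R :=
  n.+1%:R `^ alpha * (weight b n *+ (n < N)%N - weight b n.+1 *+ (n.+1 < N)%N).

(** Telescoping. It writes a weight as a sum over n >= m, so that exchanging the summations turns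
    weighted sums into box sums. *)
Lemma sum_abel_coef b N m : (m < N)%N ->
  \sum_(n < N | (m <= n)%N) n.+1%:R `^ (- alpha) * abel_coef b N n = weight b m.
Proof.
move=> mN.
under eq_bigr => n _.
  rewrite /abel_coef mulrA -powR_sum_exp// addNr powRr0 mul1r.
  over.
rewrite -(big_mkord (fun n => m <= n)%N
  (fun n => weight b n *+ (n < N)%N - weight b n.+1 *+ (n.+1 < N)%N)).
rewrite (big_cat_nat (n := m))//=; last exact: ltnW.
rewrite big_nat_cond big_pred0 ?add0r; last first.
  by move=> i /=; case: ltnP.
rewrite big_nat_cond (eq_bigl (fun i => (m <= i < N)%N && true)); last first.
  by move=> i /=; rewrite andbT andbC andbA andbb.
rewrite -big_nat_cond.
rewrite (telescope_sumr_eq (fun n => - (weight b n *+ (n < N)%N))) ?(ltnW mN)//.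
  by rewrite ltnn mN mulr0n mulr1n oppr0 opprK add0r.
by move=> i _; rewrite opprK addrC.
Qed.

Lemma abel_coef_lt b N n : (n.+1 < N)%N ->
  abel_coef b N n = n.+1%:R `^ alpha * (weight b n - weight b n.+1).
Proof. by move=> nN; rewrite /abel_coef nN (ltnW nN). Qed.

(** The boundary term of Abel summation; unlike the earlier coefficients it has no power decay. *)
Lemma abel_coef_last b n : abel_coef b n.+1 n = ln n.+1%:R ^+ b.
Proof.
rewrite /abel_coef ltnSn ltnn subr0 mulr1n /weight mulrA -powR_sum_exp//.
by rewrite subrr powRr0 mul1r.
Qed.

Lemma abel_coef_ge b N n : (N <= n)%N -> abel_coef b N n = 0.
Proof.
by move=> Nn; rewrite /abel_coef !ltnNge Nn (leq_trans Nn)// subrr mulr0.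
Qed.

Lemma ln_natS_ge0 n : 0 <= ln (n.+1%:R : R).
Proof. by rewrite ln_ge0// ler1n. Qed.

(** The derivative of x^(-alpha) (ln x)^b is O(x^(-alpha-1) (1 + ln x)^b), and the logarithms are
    absorbed by x^theta. *)
Lemma weight_increment b (theta : R) : 0 < theta -> exists2 C : R, 0 <= C &
  forall n, `|n.+1%:R `^ alpha * (weight b n - weight b n.+1)|
    <= C * n.+1%:R `^ (- 1 + theta).
Proof.
move=> t0; have [C C0 hC] := ln_pow_bound b t0.
have a0 := ltW alpha_gt0.
exists ((b%:R + alpha) * 2 ^+ b * C) => [|n].
  by rewrite mulr_ge0// mulr_ge0 ?exprn_ge0// addr_ge0// ltW.
rewrite /weight; set l := ln _; set l' := ln _.
have l0 : 0 <= l := ln_natS_ge0 n.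
have /andP[d0 d1] : 0 <= l' - l <= n.+1%:R^-1 := ln_succ_sub (ltn0Sn n).
(* The ratio of the two powers is exp(-alpha (l' - l)); this separates the change of the logarithm's
   power from that of the power of n. *)
have -> : n.+1%:R `^ alpha * (n.+1%:R `^ (- alpha) * l ^+ b - n.+2%:R `^ (- alpha) * l' ^+ b)
  = - (l' ^+ b - l ^+ b) + l' ^+ b * (1 - expR (- (alpha * (l' - l)))).
  rewrite !powR_expR_ln// -/l -/l' mulrBr !mulrA -!expRD.
  rewrite (_ : alpha * l + - alpha * l = 0); last by ring.
  rewrite (_ : alpha * l + - alpha * l' = - (alpha * (l' - l))); last by ring.
  by rewrite expR0; ring.
have ll' : l <= l' by rewrite -subr_ge0.
have l'0 := le_trans l0 ll'.
have e1 : 0 <= 1 - expR (- (alpha * (l' - l))) <= alpha * (l' - l).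
  rewrite subr_ge0 expR_le1 oppr_le0 mulr_ge0//=.
  by have := expR_ge1Dx (- (alpha * (l' - l))); lra.
have e2 : 0 <= l' ^+ b - l ^+ b by rewrite subr_ge0 lerXn2r.
have e3 := exprB_le b l0 ll'.
have e4 : l' ^+ b <= (1 + l') ^+ b.
  by rewrite lerXn2r ?nnegrE ?addr_ge0// lerDr.
have e5 : (1 + l') ^+ b <= 2 ^+ b * C * n.+1%:R `^ theta.
  have := hC n.+1%:R; rewrite ler1n => /(_ isT); rewrite -/l => h.
  rewrite -mulrA (le_trans _ (ler_wpM2l _ h)) ?exprn_ge0// -exprMn.
  rewrite lerXn2r ?nnegrE ?mulr_ge0 ?addr_ge0//.
  have d2 : l' - l <= 1 by rewrite (le_trans d1)// invf_le1// ler1n.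
  by move: l0 d2; clear; lra.
rewrite (@le_trans _ _ ((b%:R + alpha) * (1 + l') ^+ b * (l' - l)))//.
  rewrite (le_trans (ler_normD _ _))// normrN ger0_norm// mulrDl mulrDl lerD//.
  rewrite ger0_norm ?mulr_ge0 ?exprn_ge0//; last by case/andP: e1.
  case/andP: e1 => e1 e1'.
  rewrite [leRHS](_ : _ = (1 + l') ^+ b * (alpha * (l' - l))); last by ring.
  by apply: ler_pM => //; exact: exprn_ge0.
rewrite powR_sum_exp// powR_inv1//.
rewrite [leRHS](_ : _ = (b%:R + alpha) * (2 ^+ b * C * n.+1%:R `^ theta) * n.+1%:R^-1); last by ring.
have ba0 : 0 <= b%:R + alpha by rewrite addr_ge0.
apply: ler_pM => //; last exact: ler_wpM2l.
by rewrite mulr_ge0// exprn_ge0// addr_ge0.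
Qed.

(** Half of theta absorbs the logarithms. The other half leaves a summable term below the cut-off
    and N^(-theta/2) at the boundary index. *)
Lemma abel_coef_bound b (theta : R) : 0 < theta -> exists2 C : R, 0 <= C &
  forall N n, n.+1%:R `^ (- theta) * `|abel_coef b N n| <=
    C * (n.+1%:R `^ (- 1 - theta / 2) *+ (n.+1 < N)%N + N%:R `^ (- (theta / 2)) *+ (n.+1 == N)).
Proof.
move=> t0; have t2 : 0 < theta / 2 by rewrite divr_gt0.
have [C1 C10 h1] := weight_increment b t2.
have [C2 C20 h2] := ln_pow_bound b t2.
have C120 : 0 <= C1 + C2 by exact: addr_ge0.
exists (C1 + C2) => // N n.
have e : - theta = - (theta / 2) - theta / 2 by lra.
case: ltngtP => [nN|nN|nN].
- rewrite mulr1n addr0 abel_coef_lt//.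
  rewrite mulrC (le_trans (ler_wpM2r _ (h1 n))) ?powR_ge0//.
  rewrite -mulrA -powR_sum_exp// (_ : -1 + theta / 2 - theta = - 1 - theta / 2); last by lra.
  by rewrite ler_wpM2r ?powR_ge0// lerDl.
- by rewrite abel_coef_ge// normr0 mulr0 addr0 mulr0.
- rewrite add0r mulr1n -nN abel_coef_last ger0_norm ?exprn_ge0 ?ln_natS_ge0//.
  have := h2 n.+1%:R; rewrite ler1n => /(_ isT) h.
  rewrite {1}e powR_sum_exp// -mulrA [leRHS]mulrC ler_wpM2l ?powR_ge0//.
  apply: (@le_trans _ _ (n.+1%:R `^ (- (theta / 2)) * (C2 * n.+1%:R `^ (theta / 2)))).
    rewrite ler_wpM2l ?powR_ge0// (le_trans _ h)//.
    by rewrite lerXn2r ?nnegrE ?addr_ge0 ?ln_natS_ge0// lerDr.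
  by rewrite mulrCA -powR_sum_exp// addNr powRr0 mulr1 lerDr.
Qed.

Lemma natr_powRN_le1 N (r : R) : (0 < N)%N -> 0 <= r -> N%:R `^ (- r) <= 1.
Proof.
move=> N0 r0; rewrite powR_expR_ln ?ltr0n// expR_le1 mulNr oppr_le0 mulr_ge0//.
by rewrite ln_ge0// ler1n.
Qed.

(** Both parts sum [abel_coef_bound]. The second saves a power because moving the cut-off from N to
    M only affects coefficients with n + 1 >= N. *)
Lemma sum_abel_coef_bound b (theta : R) : 0 < theta -> exists2 C : R, 0 <= C &
  (forall N M, (0 < N <= M)%N ->
    \sum_(n < M) n.+1%:R `^ (- theta) * `|abel_coef b N n| <= C) /\
  (forall N M, (0 < N <= M)%N ->
    \sum_(n < M) n.+1%:R `^ (- theta) * `|abel_coef b M n - abel_coef b N n|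
      <= C * N%:R `^ (- (theta / 2))).
Proof.
move=> t0; have [C C0 hC] := abel_coef_bound b t0.
have t2 : 0 < theta / 2 by rewrite divr_gt0.
have t20 := ltW t2.
have i0 : 0 <= (theta / 2)^-1 by rewrite invr_ge0.
have one N m M : \sum_(m <= n < M) N%:R `^ (- (theta / 2)) *+ (n.+1 == N) <=
    N%:R `^ (- (theta / 2)) :> R.
  have [/andP[h1 h2]|h] := boolP ((m < N) && (N <= M))%N; last first.
    rewrite big_nat_cond big1 ?powR_ge0// => n /andP[/andP[mn nM] _].
    case: eqP => // e; case/negP: h; rewrite -e ltnS mn; exact: nM.
  rewrite -(prednK (leq_ltn_trans (leq0n _) h1)).
  rewrite (@bigD1_seq _ _ _ _ _ N.-1) ?mem_index_iota ?iota_uniq//=; last first.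
    by rewrite -ltnS (ltn_predK h1) h1.
  by rewrite eqxx mulr1n big1 ?addr0// => i /negbTE; rewrite eqSS => ->.
exists (C * (3 + (theta / 2)^-1)); first by rewrite mulr_ge0// addr_ge0.
split=> N M /andP[N0 NM].
  have /le_trans -> // : \sum_(n < M) n.+1%:R `^ (- theta) * `|abel_coef b N n|
    <= \sum_(n < M) C * (n.+1%:R `^ (- 1 - theta / 2) + N%:R `^ (- (theta / 2)) *+ (n.+1 == N :> nat)).
    apply: ler_sum => n _; apply: le_trans (hC N n) _.
    by rewrite ler_wpM2l// lerD2r; case: (_ < _)%N; rewrite ?mulr0n ?powR_ge0.
  rewrite -mulr_sumr ler_wpM2l// big_split /=.
  rewrite -(big_mkord xpredT (fun n : nat => n.+1%:R `^ (- 1 - theta / 2))).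
  rewrite -(big_mkord xpredT (fun n : nat => N%:R `^ (- (theta / 2)) *+ (n.+1 == N))).
  have := one N 0%N M; have := @sum_geometric R M _ t2.
  have := natr_powRN_le1 N0 t20.
  lra.
have N1M : (N.-1 <= M)%N by rewrite (leq_trans (leq_pred N)).
rewrite -(big_mkord xpredT
  (fun n : nat => n.+1%:R `^ (- theta) * `|abel_coef b M n - abel_coef b N n|)).
rewrite (big_cat_nat (n := N.-1))//= big_nat_cond big1 ?add0r; last first.
  move=> n /andP[/andP[_ nN] _]; rewrite !abel_coef_lt ?subrr ?normr0 ?mulr0//.
    by rewrite -(prednK N0) ltnS.
  by rewrite (leq_trans _ NM)// -(prednK N0) ltnS.
have /le_trans -> // : \sum_(N.-1 <= n < M) n.+1%:R `^ (- theta) * `|abel_coef b M n - abel_coef b N n|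
    <= \sum_(N.-1 <= n < M) C * (n.+1%:R `^ (- 1 - theta / 2) + M%:R `^ (- (theta / 2)) *+ (n.+1 == M)
      + N%:R `^ (- (theta / 2)) *+ (n.+1 == N)).
  rewrite big_seq [leRHS]big_seq; apply: ler_sum => n.
  rewrite mem_index_iota => /andP[Nn nM].
  rewrite (le_trans (ler_wpM2l _ (ler_normB _ _))) ?powR_ge0// mulrDr mulrDr.
  have Nn' : (n.+1 < N)%N = false.
    by apply/negbTE; rewrite -leqNgt -(prednK N0) ltnS.
  apply: lerD.
    apply: le_trans (hC M n) _.
    by rewrite ler_wpM2l// lerD2r; case: (_ < _)%N; rewrite ?mulr0n ?powR_ge0.
  apply: le_trans (hC N n) _.
  by rewrite Nn' mulr0n add0r.
rewrite -mulr_sumr -mulrA ler_wpM2l// !big_split /= mulrDl.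
have := one N N.-1 M; have := one M N.-1 M.
have hMN : M%:R `^ (- (theta / 2)) <= N%:R `^ (- (theta / 2)) :> R.
  have M0 := leq_trans N0 NM.
  rewrite !powR_expR_ln ?ltr0n// ler_expR !mulNr lerN2 ler_wpM2l//.
  by rewrite ler_ln ?posrE ?ltr0n// ler_nat.
have : \sum_(N.-1 <= n < M) n.+1%:R `^ (- 1 - theta / 2) <=
    (1 + (theta / 2)^-1) * N%:R `^ (- (theta / 2)) :> R.
  (* The tail bound covers n >= N, so the term n = N - 1 is split off. *)
  rewrite big_ltn; last by rewrite prednK.
  rewrite (prednK N0) mulrDl mul1r lerD//; last exact: sum_geometric_tail.
  by rewrite powR_sum_exp ?ltr0n// ler_piMl ?powR_ge0// natr_powRN_le1.
rewrite mulrDl mul1r; lra.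
Qed.

Lemma abel_by_parts (a W : nat -> R) N :
  \sum_(n < N) a n.+1 * (W n - W n.+1) =
  \sum_(n < N) (a n.+1 - a n) * W n + a 0%N * W 0%N - a N * W N.
Proof.
elim: N => [|N IH]; first by rewrite !big_ord0 add0r subrr.
by rewrite !big_ord_recr /= IH; ring.
Qed.

(** Summation by parts moves the difference onto n^alpha. Both boundary terms vanish: 0^alpha = 0 as
    alpha > 0, and the truncated weight is 0 at N. *)
Lemma sum_abel_coef_weight b N : \sum_(n < N) abel_coef b N n =
  \sum_(n < N) (n.+1%:R `^ alpha - n%:R `^ alpha) * weight b n.
Proof.
rewrite [LHS](abel_by_parts (fun n => n%:R `^ alpha) (fun n => weight b n *+ (n < N)%N)).
rewrite ltnn mulr0n mulr0 subr0 powR0 ?gt_eqF// mul0r addr0.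
by apply: eq_bigr => n _; rewrite ltn_ord.
Qed.

(** With d = ln(n+1) - ln n the left term is (ln(n+1))^b (1 - exp(-alpha d)), close to alpha d
    (ln(n+1))^b, which is close to the right term. Both errors are O((1 + ln(n+1))^b / n^2), hence
    O(n^(-3/2)). *)
Lemma weighted_increment_approx b : exists2 C : R, 0 <= C & forall n, (0 < n)%N ->
  `|(n.+1%:R `^ alpha - n%:R `^ alpha) * weight b n
    - alpha / b.+1%:R * (ln n.+1%:R ^+ b.+1 - ln n%:R ^+ b.+1)|
  <= C * n.+1%:R `^ (- 1 - 2^-1).
Proof.
have h0 : (0 : R) < 2^-1 by rewrite invr_gt0.
have [C C0 hC] := ln_pow_bound b h0.
have a0 := ltW alpha_gt0.
exists ((alpha ^+ 2 + alpha * b%:R) * 4 * C) => [|n n0].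
  by rewrite !mulr_ge0// addr_ge0 ?exprn_ge0// mulr_ge0.
rewrite /weight; set l := ln n.+1%:R; set x := ln n%:R.
have l0 : 0 <= l := ln_natS_ge0 n.
have x0 : 0 <= x by rewrite ln_ge0// ler1n.
have /andP[] : 0 <= l - x <= n%:R^-1 := ln_succ_sub n0.
set d := l - x => d0 d1.
have xl : x <= l by rewrite -subr_ge0.
have -> : (n.+1%:R `^ alpha - n%:R `^ alpha) * (n.+1%:R `^ (- alpha) * l ^+ b) =
    l ^+ b * (1 - expR (- (alpha * d))).
  rewrite !powR_expR_ln ?ltr0n// -/l -/x mulrA mulrBl -!expRD.
  rewrite (_ : alpha * l + - alpha * l = 0); last by ring.
  rewrite (_ : alpha * x + - alpha * l = - (alpha * d)); last by rewrite /d; ring.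
  by rewrite expR0 mulrC.
have [e1 e2] : b.+1%:R * x ^+ b * d <= l ^+ b.+1 - x ^+ b.+1 /\
    l ^+ b.+1 - x ^+ b.+1 <= b.+1%:R * l ^+ b * d.
  by apply/andP; exact: exprB_bernoulli.
have e3 : l ^+ b - x ^+ b <= b%:R * (1 + l) ^+ b * d := exprB_le b x0 xl.
have e4 := expR_quadratic (mulr_ge0 a0 d0).
set P := (1 + l) ^+ b in e3 *.
have P0 : 0 <= P by rewrite exprn_ge0// addr_ge0.
have e5 : l ^+ b <= P by rewrite lerXn2r ?nnegrE ?addr_ge0// lerDr.
(* [Q] is the integral of t^b from [x] to [l]. *)
set Q := (l ^+ b.+1 - x ^+ b.+1) / b.+1%:R.
have Q1 : x ^+ b * d <= Q.
  by rewrite ler_pdivlMr// mulrC mulrA.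
have Q2 : Q <= l ^+ b * d.
  by rewrite ler_pdivrMr// [leRHS]mulrC mulrA.
have Q3 : `|l ^+ b * d - Q| <= b%:R * P * d ^+ 2.
  rewrite ger0_norm ?subr_ge0//.
  have : (l ^+ b - x ^+ b) * d <= b%:R * P * d * d by rewrite ler_wpM2r.
  by rewrite mulrBl expr2 mulrA => h; lra.
have hd : d ^+ 2 <= 4 * n.+1%:R `^ (- 2).
  have dn : d <= 2 * n.+1%:R^-1.
    rewrite (le_trans d1)// -[leLHS]mul1r ler_pdivrMr ?ltr0n// mulrAC.
    by rewrite ler_pdivlMr ?ltr0n// mul1r -natrM ler_nat mul2n -addnn -addn1 leq_add2l.
  rewrite powR_invn// -exprVn (_ : 4 = 2 ^+ 2) -?exprMn; last by rewrite -natrX.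
  by rewrite lerXn2r ?nnegrE ?mulr_ge0 ?invr_ge0.
have hP : P <= C * n.+1%:R `^ 2^-1 by apply: hC; rewrite ler1n.
have -> : alpha / b.+1%:R * (l ^+ b.+1 - x ^+ b.+1) = alpha * Q by rewrite /Q; ring.
have -> : l ^+ b * (1 - expR (- (alpha * d))) - alpha * Q =
  l ^+ b * (1 - expR (- (alpha * d)) - alpha * d) + alpha * (l ^+ b * d - Q) by ring.
apply: (@le_trans _ _ ((alpha ^+ 2 + alpha * b%:R) * P * d ^+ 2)).
  rewrite (le_trans (ler_normD _ _))// !normrM (ger0_norm a0).
  rewrite [`|_ ^+ b|]ger0_norm ?exprn_ge0// mulrDl mulrDl lerD//.
    rewrite [leRHS](_ : _ = P * (alpha * d) ^+ 2); last by ring.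
    by apply: ler_pM => //; exact: exprn_ge0.
  rewrite -!mulrA ler_wpM2l// mulrA.
  exact: Q3.
rewrite (_ : -1 - 2^-1 = 2^-1 + (- 2)); last by lra.
rewrite powR_sum_exp//.
rewrite [leRHS](_ : _ = (alpha ^+ 2 + alpha * b%:R) * (C * n.+1%:R `^ 2^-1)
  * (4 * n.+1%:R `^ (- 2))); last by ring.
apply: ler_pM => //.
- by rewrite mulr_ge0// addr_ge0 ?exprn_ge0// mulr_ge0.
- exact: exprn_ge0.
by rewrite ler_wpM2l// addr_ge0 ?exprn_ge0// mulr_ge0.
Qed.

(** By the previous estimate the difference of sum and main term has increments O(n^(-3/2)), so it
    converges with rate N^(-1/2); [g] is its limit, a constant of Euler's type. *)
Lemma sum_abel_coef_asymp b : exists g C : R, forall N, (0 < N)%N ->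
  `|\sum_(n < N) abel_coef b N n - (alpha / b.+1%:R * ln N%:R ^+ b.+1 + g)|
    <= C * N%:R `^ (- 2^-1).
Proof.
have [C C0 hC] := weighted_increment_approx b.
have h0 : (0 : R) < 2^-1 by rewrite invr_gt0.
pose u N := \sum_(n < N) abel_coef b N n - alpha / b.+1%:R * ln (N%:R : R) ^+ b.+1.
have [g hg] : exists g, forall N, (0 < N)%N -> `|u N - g| <= (C * 2) * N%:R `^ (- 2^-1).
  apply: cauchy_rate => N M /andP[N0 NM].
  have -> : u N - u M = - \sum_(N <= n < M) ((n.+1%:R `^ alpha - n%:R `^ alpha) * weight b n
    - alpha / b.+1%:R * (ln n.+1%:R ^+ b.+1 - ln n%:R ^+ b.+1)).
    rewrite /u !sum_abel_coef_weight sumrB -mulr_sumr.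
    rewrite (telescope_sumr (fun n : nat => ln (n%:R : R) ^+ b.+1))//.
    rewrite -!(big_mkord xpredT (fun n : nat => (n.+1%:R `^ alpha - n%:R `^ alpha) * weight b n)).
    rewrite (big_cat_nat (n := N) (p := M))//=; ring.
  rewrite normrN (le_trans (ler_norm_sum _ _ _))//.
  apply: (@le_trans _ _ (\sum_(N <= n < M) C * n.+1%:R `^ (- 1 - 2^-1))).
    rewrite big_seq [leRHS]big_seq; apply: ler_sum => n.
    rewrite mem_index_iota => /andP[Nn _]; apply: hC.
    exact: leq_trans N0 Nn.
  rewrite -mulr_sumr -mulrA ler_wpM2l//.
  by rewrite -[X in X * _]invrK; exact: sum_geometric_tail.
exists g, (C * 2) => N N0; have := hg N N0.
by rewrite /u opprD addrA.
Qed.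

End weights.

(** * Polynomials in the logarithm with power-saving error *)

Section products.
Context {R : realType}.

(** Induction through a A - b B = a (A - B) + (a - b) B. The bound is left as a difference of
    products because, summed over all index vectors, each product factors into one-variable sums. *)
Lemma prodB_norm_le (I : finType) (P : pred I) (a b beta d : I -> R) :
  (forall i, `|b i| <= beta i) -> (forall i, `|a i - b i| <= d i) ->
  `|\prod_(i | P i) a i - \prod_(i | P i) b i| <=
    \prod_(i | P i) (beta i + d i) - \prod_(i | P i) beta i.
Proof.
move=> hb hd.
have b0 i : 0 <= beta i := le_trans (normr_ge0 _) (hb i).
have d0 i : 0 <= d i := le_trans (normr_ge0 _) (hd i).
suff [] : [/\ `|\prod_(i | P i) a i - \prod_(i | P i) b i| <=
    \prod_(i | P i) (beta i + d i) - \prod_(i | P i) beta i,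
    `|\prod_(i | P i) b i| <= \prod_(i | P i) beta i &
    0 <= \prod_(i | P i) (beta i + d i)] by [].
elim: (index_enum I) => [|i s [IH1 IH2 IH3]].
  by rewrite !big_nil !subrr normr0 normr1.
rewrite !big_cons; case: (P i) => //.
set A := \prod_(_ <- s | _) a _ in IH1 *.
set B := \prod_(_ <- s | _) b _ in IH1 IH2 *.
set Q := \prod_(_ <- s | _) beta _ in IH1 IH2 *.
set S := \prod_(_ <- s | _) (_ + _) in IH1 IH3 *.
have Q0 : 0 <= Q := le_trans (normr_ge0 _) IH2.
split.
- rewrite (_ : a i * A - b i * B = a i * (A - B) + (a i - b i) * B); last by ring.
  rewrite (le_trans (ler_normD _ _))// !normrM.
  have ha : `|a i| <= beta i + d i.
    rewrite -[a i](subrK (b i)) (le_trans (ler_normD _ _))// addrC lerD//.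
  have h1 := ler_pM (normr_ge0 _) (normr_ge0 _) ha IH1.
  have h2 := ler_pM (normr_ge0 _) (normr_ge0 _) (hd i) IH2.
  apply: le_trans (lerD h1 h2) _; rewrite le_eqVlt; apply/orP; left; apply/eqP; ring.
- by rewrite normrM ler_pM.
- by rewrite mulr_ge0// addr_ge0.
Qed.

(* Convexity of [e |-> prod (B + e C)] on [0, 1]. *)
Lemma prod_perturb_le (I : finType) (P : pred I) (B C : I -> R) (e : R) :
  0 <= e <= 1 -> (forall i, 0 <= B i) -> (forall i, 0 <= C i) ->
  \prod_(i | P i) (B i + e * C i) - \prod_(i | P i) B i <=
    e * \prod_(i | P i) (B i + C i).
Proof.
move=> /andP[e0 e1] B0 C0.
suff [] : [/\ \prod_(i | P i) (B i + e * C i) - \prod_(i | P i) B i <=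
    e * (\prod_(i | P i) (B i + C i) - \prod_(i | P i) B i),
    0 <= \prod_(i | P i) B i & \prod_(i | P i) B i <= \prod_(i | P i) (B i + C i)].
  by move=> h h1 h2; apply: le_trans h _; rewrite ler_wpM2l// gerBl.
elim: (index_enum I) => [|i s [IH1 IH2 IH3]].
  by rewrite !big_nil !subrr mulr0.
rewrite !big_cons; case: (P i) => //.
set X := \prod_(_ <- s | _) (B _ + e * _) in IH1 *.
set Y := \prod_(_ <- s | _) B _ in IH1 IH2 IH3 *.
set Z := \prod_(_ <- s | _) (_ + _) in IH1 IH3 *.
have Bi := B0 i; have Ci := C0 i.
have XZ : X <= Z.
  have : e * (Z - Y) <= 1 * (Z - Y) by rewrite ler_wpM2r// subr_ge0.
  by rewrite mul1r; lra.
split.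
- have h1 := ler_wpM2l Bi IH1.
  have h2 := ler_wpM2l (mulr_ge0 e0 Ci) XZ.
  rewrite [leLHS](_ : _ = B i * (X - Y) + e * C i * X); last by ring.
  apply: le_trans (lerD h1 h2) _; rewrite le_eqVlt; apply/orP; left; apply/eqP; ring.
- exact: mulr_ge0.
- by rewrite mulrDl -[leLHS]addr0 lerD ?ler_wpM2l// mulr_ge0// (le_trans IH2).
Qed.

End products.

Section log_polynomials.
Context {R : realType}.

Lemma horner_bound d (p : {poly R}) (C y : R) : (size p <= d.+1)%N ->
  (forall i, `|p`_i| <= C) -> 0 <= y -> `|p.[y]| <= d.+1%:R * C * (1 + y) ^+ d.
Proof.
move=> sp pC y0; rewrite (horner_coef_wide _ sp) (le_trans (ler_norm_sum _ _ _))//.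
have C0 : 0 <= C := le_trans (normr_ge0 _) (pC 0%N).
rewrite [leRHS](_ : _ = \sum_(i < d.+1) C * (1 + y) ^+ d); last first.
  by rewrite sumr_const card_ord -mulrA mulr_natl.
apply: ler_sum => i _; rewrite normrM normrX (ger0_norm y0) ler_pM ?exprn_ge0//.
apply: (@le_trans _ _ ((1 + y) ^+ i)).
  by rewrite lerXn2r ?nnegrE ?addr_ge0// lerDr.
by rewrite ler_weXn2l ?lerDl// -ltnS.
Qed.

Lemma horner_lipschitz d (p : {poly R}) (C x y : R) : (size p <= d.+1)%N ->
  (forall i, `|p`_i| <= C) -> 0 <= x -> x <= y ->
  `|p.[y] - p.[x]| <= d.+1%:R * C * (d%:R * (1 + y) ^+ d * (y - x)).
Proof.
move=> sp pC x0 xy; have y0 := le_trans x0 xy.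
have C0 : 0 <= C := le_trans (normr_ge0 _) (pC 0%N).
rewrite !(horner_coef_wide _ sp) -sumrB (le_trans (ler_norm_sum _ _ _))//.
rewrite [leRHS](_ : _ = \sum_(i < d.+1) C * (d%:R * (1 + y) ^+ d * (y - x))); last first.
  by rewrite sumr_const card_ord -mulrA mulr_natl.
apply: ler_sum => i _; rewrite -mulrBr normrM ler_pM//.
rewrite ger0_norm ?subr_ge0 ?lerXn2r//.
rewrite (le_trans (exprB_le i x0 xy))// ler_wpM2r ?subr_ge0//.
rewrite ler_pM ?exprn_ge0 ?addr_ge0 ?ler_nat -1?ltnS//.
by rewrite ler_weXn2l ?lerDl// -ltnS.
Qed.

Context {T : Type} (H : set T).

(** [eta] and [C] precede [h], which makes the expansion uniform over [H]. The coefficient [l h] in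
    degree [d] may be zero, and the uniform bound on all coefficients is what lets expansions be
    multiplied. *)
Definition asym (d : nat) (l : T -> R) (u : T -> nat -> R) : Prop :=
  exists2 eta : R, 0 < eta & exists2 C : R, 0 <= C &
  forall h, H h -> exists p : {poly R},
    [/\ (size p <= d.+1)%N, p`_d = l h, forall i, `|p`_i| <= C &
        forall N, (0 < N)%N -> `|u h N - p.[ln N%:R]| <= C * N%:R `^ (- eta)].

Lemma natr_powRN_homo N (r s : R) : (0 < N)%N -> r <= s -> N%:R `^ (- s) <= N%:R `^ (- r) :> R.
Proof.
move=> N0 rs; rewrite !powR_expR_ln ?ltr0n// ler_expR !mulNr lerN2 ler_wpM2r//.
by rewrite ln_ge0// ler1n.
Qed.

Lemma asym_ext d l l' u u' : (forall h, H h -> l h = l' h) ->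
  (forall h N, H h -> (0 < N)%N -> u h N = u' h N) -> asym d l u -> asym d l' u'.
Proof.
move=> ll uu [eta e0 [C C0 hC]]; exists eta => //; exists C => // h Hh.
have [p [h1 h2 h3 h4]] := hC h Hh; exists p; split => //.
  by rewrite h2 ll.
by move=> N N0; rewrite -uu//; exact: h4.
Qed.

Lemma asym_limit (l : T -> R) u (B C eta : R) : 0 < eta ->
  (forall h, H h -> `|l h| <= B) ->
  (forall h N, H h -> (0 < N)%N -> `|u h N - l h| <= C * N%:R `^ (- eta)) ->
  asym 0 l u.
Proof.
move=> e0 lB uC; exists eta => //; exists (`|B| + `|C|); first exact: addr_ge0.
move=> h Hh; exists (l h)%:P; split.
- by rewrite size_polyC; case: eqP.
- by rewrite coefC eqxx.
- move=> i; rewrite coefC; case: eqP => _; last by rewrite normr0 addr_ge0.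
  by rewrite (le_trans (lB _ Hh))// (le_trans (ler_norm _))// lerDl.
- move=> N N0; rewrite hornerC (le_trans (uC _ _ Hh N0))// ler_wpM2r ?powR_ge0//.
  by rewrite (le_trans (ler_norm _))// lerDr.
Qed.

Lemma asymD d l1 l2 u1 u2 : asym d l1 u1 -> asym d l2 u2 ->
  asym d (fun h => l1 h + l2 h) (fun h N => u1 h N + u2 h N).
Proof.
move=> [e1 e10 [C1 C10 h1]] [e2 e20 [C2 C20 h2]].
exists (Num.min e1 e2); first by rewrite lt_min e10.
exists (C1 + C2) => [|h Hh]; first exact: addr_ge0.
have [p [p1 p2 p3 p4]] := h1 h Hh; have [q [q1 q2 q3 q4]] := h2 h Hh.
exists (p + q); split.
- by rewrite (leq_trans (size_polyD _ _))// geq_max p1.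
- by rewrite coefD p2 q2.
- by move=> i; rewrite coefD (le_trans (ler_normD _ _))// lerD.
- move=> N N0; rewrite hornerD opprD addrACA (le_trans (ler_normD _ _))//.
  rewrite mulrDl lerD//.
    by rewrite (le_trans (p4 _ N0))// ler_wpM2l// natr_powRN_homo// ge_min lexx.
  by rewrite (le_trans (q4 _ N0))// ler_wpM2l// natr_powRN_homo// ge_min lexx orbT.
Qed.

(** Meant for contributions of lower degree, which then have top coefficient 0. *)
Lemma asym_widen d e l u : (d < e)%N -> asym d l u -> asym e (fun=> 0) u.
Proof.
move=> de [eta e0 [C C0 hC]]; exists eta => //; exists C => // h Hh.
have [p [h1 h2 h3 h4]] := hC h Hh; exists p; split => //.
  by rewrite (leq_trans h1)// (leq_trans de).
by rewrite nth_default// (leq_trans h1).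
Qed.

(** From U V - P Q = (U - P) V + (V - Q) P. The logarithms in P and V cost at most N^(e/2), so half
    of the smaller exponent remains. *)
Lemma asymM d1 d2 l1 l2 u1 u2 : asym d1 l1 u1 -> asym d2 l2 u2 ->
  asym (d1 + d2) (fun h => l1 h * l2 h) (fun h N => u1 h N * u2 h N).
Proof.
move=> [e1 e10 [C1 C10 h1]] [e2 e20 [C2 C20 h2]].
pose e := Num.min e1 e2.
have e0 : 0 < e by rewrite lt_min e10.
have e20' : 0 < e / 2 by rewrite divr_gt0.
have [K1 K10 hK1] := ln_pow_bound d1 e20'.
have [K2 K20 hK2] := ln_pow_bound d2 e20'.
pose C := C1 * (d2.+1%:R * C2 * K2 + C2) + C2 * (d1.+1%:R * C1 * K1).
pose C' := (d1 + d2).+1%:R * (C1 * C2).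
have C'0 : 0 <= C' by rewrite !mulr_ge0.
have C0 : 0 <= C by rewrite !(addr_ge0, mulr_ge0).
exists (e / 2) => //; exists (C + C') => [|h Hh]; first exact: addr_ge0.
have [p [p1 p2 p3 p4]] := h1 h Hh; have [q [q1 q2 q3 q4]] := h2 h Hh.
exists (p * q).
have spq : (size (p * q)%R <= (d1 + d2).+1)%N.
  rewrite (leq_trans (size_polyMleq _ _))//.
  have := leq_add p1 q1; rewrite addSn addnS.
  by case: (_ + _)%N.
split => //.
(* For i < [d1] the factor from [q] has index above [d2]; for i > [d1] the factor from [p]
   vanishes. *)
- rewrite coefM (bigD1 (inord d1))//= inordK ?ltnS ?leq_addr// addKn p2 q2.
  rewrite big1 ?addr0// => i; rewrite -val_eqE /= inordK ?ltnS ?leq_addr//.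
  case: ltngtP => // hi _.
    rewrite [q`_ _]nth_default ?mulr0// (leq_trans q1)//.
    by rewrite -addnBAC ?(ltnW hi)// -[X in (X < _)%N]add0n ltn_add2r subn_gt0.
  by rewrite [p`_ _]nth_default ?mul0r// (leq_trans p1).
- move=> i; have [hi|hi] := leqP (d1 + d2).+1 i.
    by rewrite nth_default ?(leq_trans spq)// normr0 addr_ge0.
  rewrite coefM (le_trans (ler_norm_sum _ _ _))//.
  apply: (@le_trans _ _ (\sum_(j < i.+1) C1 * C2)).
    by apply: ler_sum => j _; rewrite normrM ler_pM.
  rewrite sumr_const card_ord -mulr_natl (@le_trans _ _ C')// ?lerDr//.
  by rewrite ler_wpM2r ?mulr_ge0// ler_nat.
- move=> N N0; rewrite hornerM.
  set P := p.[_]; set Q := q.[_]; set U := u1 h N; set V := u2 h N.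
  rewrite (_ : U * V - P * Q = (U - P) * V + (V - Q) * P); last by ring.
  have L0 : 0 <= ln (N%:R : R) by rewrite ln_ge0// ler1n.
  have N1 : 1 <= (N%:R : R) by rewrite ler1n.
  have E1 : 1 <= N%:R `^ (e / 2) :> R.
    by rewrite powR_expR_ln ?ltr0n// -[leLHS]expR0 ler_expR mulr_ge0// ltW.
  have E2 : N%:R `^ (- e) * N%:R `^ (e / 2) = N%:R `^ (- (e / 2)) :> R.
    by rewrite -powR_sum_exp ?ltr0n//; congr (_ `^ _); lra.
  have PK : `|P| <= d1.+1%:R * C1 * K1 * N%:R `^ (e / 2).
    rewrite (le_trans (horner_bound p1 p3 L0))// -[leRHS]mulrA ler_wpM2l ?mulr_ge0//.
    exact: hK1.
  have QK : `|Q| <= d2.+1%:R * C2 * K2 * N%:R `^ (e / 2).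
    rewrite (le_trans (horner_bound q1 q3 L0))// -[leRHS]mulrA ler_wpM2l ?mulr_ge0//.
    exact: hK2.
  have UP : `|U - P| <= C1 * N%:R `^ (- e).
    by rewrite (le_trans (p4 _ N0))// ler_wpM2l// natr_powRN_homo// ge_min lexx.
  have VQ : `|V - Q| <= C2 * N%:R `^ (- e).
    by rewrite (le_trans (q4 _ N0))// ler_wpM2l// natr_powRN_homo// ge_min lexx orbT.
  have e1' := natr_powRN_le1 N0 (ltW e0).
  have VK : `|V| <= (d2.+1%:R * C2 * K2 + C2) * N%:R `^ (e / 2).
    rewrite -[V](subrK Q) (le_trans (ler_normD _ _))// addrC mulrDl lerD//.
    rewrite (le_trans VQ)// ler_wpM2l// (le_trans _ E1)//.
  rewrite (le_trans (ler_normD _ _))// !normrM.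
  have m1 := ler_pM (normr_ge0 _) (normr_ge0 _) UP VK.
  have m2 := ler_pM (normr_ge0 _) (normr_ge0 _) VQ PK.
  apply: le_trans (lerD m1 m2) _.
  rewrite [leLHS](_ : _ = C * (N%:R `^ (- e) * N%:R `^ (e / 2))); last by rewrite /C; ring.
  by rewrite E2 ler_wpM2r ?powR_ge0// lerDl.
Qed.

Lemma asym_sum (I : finType) (P : pred I) d (l : I -> T -> R) u :
  (forall i, P i -> asym d (l i) (u i)) ->
  asym d (fun h => \sum_(i | P i) l i h) (fun h N => \sum_(i | P i) u i h N).
Proof.
move=> hi; elim: (index_enum I) => [|i s IH].
  exists 1 => //; exists 0 => // h _; exists 0; split.
  - by rewrite size_poly0.
  - by rewrite coef0 big_nil.
  - by move=> ?; rewrite coef0 normr0.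
  - by move=> N _; rewrite big_nil horner0 subrr normr0 mul0r.
have [Pi|Pi] := boolP (P i).
  apply: (asym_ext _ _ (asymD (hi i Pi) IH)) => [h _|h N _ _];
    by rewrite big_cons Pi.
by apply: (asym_ext _ _ IH) => [h _|h N _ _]; rewrite big_cons (negbTE Pi).
Qed.

Lemma asym_prod (I : finType) (P : pred I) (d : I -> nat) (l : I -> T -> R) u :
  (forall i, P i -> asym (d i) (l i) (u i)) ->
  asym (\sum_(i | P i) d i) (fun h => \prod_(i | P i) l i h)
    (fun h N => \prod_(i | P i) u i h N).
Proof.
move=> hi; elim: (index_enum I) => [|i s IH].
  rewrite big_nil; apply: (@asym_limit _ _ 1 0 1) => // [h _|h N _ _].
    by rewrite big_nil normr1.
  by rewrite !big_nil subrr normr0 mul0r.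
have [Pi|Pi] := boolP (P i); last first.
  rewrite big_cons (negbTE Pi).
  by apply: (asym_ext _ _ IH) => [h _|h N _ _]; rewrite big_cons (negbTE Pi).
rewrite big_cons Pi.
apply: (asym_ext _ _ (asymM (hi i Pi) IH)) => [h _|h N _ _];
  by rewrite big_cons Pi.
Qed.

(** For N the integer part of X, X/2 <= N turns N^(-e) into X^(-e), and ln X - ln N <= 2/X allows ln
    X as argument of the polynomial at a cost of (1 + ln X)^d / X, which is O(X^(-1/2)). *)
Lemma asym_real d l u : asym d l u -> exists2 eta : R, 0 < eta & exists C : R,
  forall h, H h -> exists p : {poly R},
    [/\ (size p <= d.+1)%N, p`_d = l h & forall X : R, 1 < X ->
      `|u h (Num.truncn X) - p.[ln X]| <= C * X `^ (- eta)].
Proof.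
move=> [e e0 [C C0 hC]].
have h0 : (0 : R) < 2^-1 by rewrite invr_gt0.
have [K K0 hK] := ln_pow_bound d h0.
exists (Num.min e 2^-1); first by rewrite lt_min e0.
exists (C * 2 `^ e + d.+1%:R * C * (d%:R * K * 2)) => h Hh.
have [p [p1 p2 p3 p4]] := hC h Hh; exists p; split=> // X X1.
have X0 : 0 < X := lt_trans ltr01 X1.
have /andP[N1 N2] := Num.Theory.truncn_itv (ltW X0).
set N := Num.truncn X in N1 N2 *.
have N0 : (0 < N)%N.
  by rewrite Num.Theory.truncn_gt0 ltW.
have N0R : 0 < (N%:R : R) by rewrite ltr0n.
have X2N : X / 2 <= N%:R.
  rewrite ler_pdivrMr// (le_trans (ltW N2))// -natrM ler_nat muln2 -addnn -addn1.
  by rewrite leq_add2l.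
rewrite -(subrK p.[ln N%:R] (u h N)) -addrA (le_trans (ler_normD _ _))//.
rewrite mulrDl lerD//.
  rewrite (le_trans (p4 _ N0))// -mulrA ler_wpM2l//.
  rewrite (@le_trans _ _ ((X / 2) `^ (- e)))//.
    rewrite !powR_expR_ln ?divr_gt0// ler_expR !mulNr lerN2 ler_wpM2l ?(ltW e0)//.
    by rewrite ler_ln ?posrE ?divr_gt0.
  have -> : (X / 2) `^ (- e) = 2 `^ e * X `^ (- e).
    rewrite powRM ?invr_ge0 ?(ltW X0)// mulrC; congr (_ * _).
    by rewrite -[in LHS]powR_inv1// -powRrM mulN1r opprK.
  by rewrite ler_wpM2l ?powR_ge0// ler_powR ?(ltW X1)// lerN2 ge_min lexx.
rewrite distrC.
have L0 : 0 <= ln (N%:R : R) by rewrite ln_ge0// ler1n.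
have LX : ln N%:R <= ln X by rewrite ler_ln.
rewrite (le_trans (horner_lipschitz p1 p3 L0 LX))// -[leRHS]mulrA ler_wpM2l ?mulr_ge0//.
have dl : ln X - ln N%:R <= 2 * X `^ (-1).
  have /andP[_ hl] := ln_succ_sub (R := R) N0.
  have : ln X <= ln N.+1%:R by rewrite ler_ln ?posrE ?ltr0n// ltW.
  have : N%:R^-1 <= 2 * X `^ (-1).
    rewrite powR_inv1 ?(ltW X0)// (_ : 2 * X^-1 = (X / 2)^-1); last by rewrite invf_div.
    by rewrite lef_pV2 ?posrE ?divr_gt0.
  by move: hl; clear; lra.
have hX := hK X (ltW X1).
have m := ler_pM _ _ hX dl.
rewrite -!mulrA ler_wpM2l//.
apply: le_trans (m _ _) _; rewrite ?subr_ge0 ?exprn_ge0 ?addr_ge0 ?ln_ge0 ?(ltW X1)//.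
rewrite -mulrA ler_wpM2l// mulrCA ler_wpM2l// -powR_sum_exp//.
rewrite ler_powR ?(ltW X1)// (_ : 2^-1 + -1 = - 2^-1); last by lra.
by rewrite lerN2 ge_min lexx orbT.
Qed.

End log_polynomials.

(** * Sums over boxes *)

Section boxes.
Context {R : realType}.

Definition pos (m : nat) : posint := exist _ m.+1 (ltn0Sn m).

(* Zero-based coding: the function [n] stands for the vector with entries [n i + 1]. *)
Definition vec k (n : 'I_k -> nat) : k.-tuple posint := [tuple pos (n i) | i < k].

Lemma tnth_vec k (n : 'I_k -> nat) i : tnth (vec n) i = pos (n i).
Proof. by rewrite tnth_mktuple. Qed.

Lemma tnth_toR k (x : k.-tuple posint) i : tnth (toR x) i = (val (tnth x i))%:R :> R.
Proof. by rewrite tnth_mktuple. Qed.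

Lemma vec_surj k (x : k.-tuple posint) : x = vec (fun i => (val (tnth x i)).-1).
Proof.
apply: eq_from_tnth => i; rewrite tnth_vec; apply: val_inj => /=.
by rewrite prednK//; exact: (valP (tnth x i)).
Qed.

(** Any N with all entries of X below N + 1 is allowed, so that sums over different boxes can share
    one index type. *)
Lemma ffun_box_bij s (X : s.-tuple R) N : (forall i, tnth X i < N.+1%:R) ->
  set_bij [set` (fun a : {ffun 'I_s -> 'I_N} => [forall i, (a i).+1%:R <= tnth X i])]
    (box X) (fun a => vec (fun i => a i : nat)).
Proof.
move=> XN; split.
- by move=> a /= /forallP ha i; rewrite tnth_toR tnth_vec; exact: ha.
- move=> a b _ _ /= ab; apply/ffunP => i; apply: ord_inj.
  by have /(congr1 (fun x => tnth x i)) := ab; rewrite !tnth_vec => -[].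
- move=> x xX.
  have xN i : ((val (tnth x i)).-1 < N)%N.
    have := le_lt_trans (xX i) (XN i); rewrite tnth_toR ltr_nat ltnS.
    by case: (tnth x i) => -[].
  exists [ffun i => Ordinal (xN i)].
    rewrite /=; apply/forallP => i; rewrite ffunE /= prednK; last exact: (valP (tnth x i)).
    by have := xX i; rewrite tnth_toR.
  rewrite [RHS]vec_surj; congr vec; apply/funext => i.
  by rewrite ffunE.
Qed.

Lemma box_sumE s (X : s.-tuple R) N (phi : s.-tuple posint -> R) :
  (forall i, tnth X i < N.+1%:R) ->
  \sum_(x \in box X) phi x =
  \sum_(a : {ffun 'I_s -> 'I_N} | [forall i, (a i).+1%:R <= tnth X i])
    phi (vec (fun i => a i : nat)).
Proof.
move=> XN; rewrite (reindex_fsbig (fun a : {ffun 'I_s -> 'I_N} => vec (fun i => a i : nat)) _ _ _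
  (ffun_box_bij XN)).
by apply/esym/bigfs => [|i _]; rewrite ?mem_index_enum// index_enum_uniq.
Qed.

Lemma tuple_bound s (X : s.-tuple R) : exists N : nat, forall i, tnth X i < N.+1%:R.
Proof.
exists (\max_(i < s) Num.truncn (tnth X i)) => i.
by rewrite (lt_le_trans (Num.Theory.truncnS_gt _))// ler_nat ltnS; exact: leq_bigmax.
Qed.

Lemma finite_box s (X : s.-tuple R) : finite_set (box X).
Proof.
have [N XN] := tuple_bound X.
have [hf _ hs] := ffun_box_bij XN.
have -> : box X = [set (vec (fun i => a i : nat)) | a in
    [set` (fun a : {ffun 'I_s -> 'I_N} => [forall i, (a i).+1%:R <= tnth X i])]].
  by apply/seteqP; split=> [x /hs//|_ [a ha <-]]; exact: hf.
exact/finite_image/finite_finset.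
Qed.

Lemma box_sum_permute k (X X' : k.-tuple R) (sigma : 'S_k) (h : k.-tuple posint -> R) :
  (forall i, tnth X i = tnth X' (sigma i)) ->
  \sum_(x \in box X) h x = \sum_(x \in box X') permute sigma h x.
Proof.
move=> XX.
rewrite (reindex_fsbig (fun y : k.-tuple posint => [tuple tnth y (sigma i) | i < k]) (box X'))//.
split.
- by move=> y yX i; rewrite tnth_toR tnth_mktuple XX -tnth_toR; exact: yX.
- move=> y z _ _ /= yz; apply: eq_from_tnth => i.
  have /(congr1 (fun x => tnth x ((sigma^-1)%g i))) := yz.
  by rewrite !tnth_mktuple permKV.
- move=> x xX; exists [tuple tnth x ((sigma^-1)%g i) | i < k].
    move=> i; rewrite tnth_toR tnth_mktuple -tnth_toR.
    by rewrite -[X in tnth X' X](permKV sigma) -XX; exact: xX.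
  by apply: eq_from_tnth => i; rewrite !tnth_mktuple permK.
Qed.

Lemma box_sum_concat k r s (e : (r + s)%N = k) (X : k.-tuple R) (U : r.-tuple R)
    (V : s.-tuple R) (h : k.-tuple posint -> R) :
  (forall i, tnth U i = tnth X (cast_ord e (lshift s i))) ->
  (forall i, tnth V i = tnth X (cast_ord e (rshift r i))) ->
  \sum_(x \in box X) h x = \sum_(u \in box U) \sum_(v \in box V) h (vconcat e u v).
Proof.
case: _ / e in X h * => hU hV.
rewrite pair_fsbig; [|exact: finite_box|exact: finite_box].
rewrite (reindex_fsbig (fun p : r.-tuple posint * s.-tuple posint =>
  vconcat (erefl (r + s)%N) p.1 p.2) (box U `*` box V))//.
have tl (u : r.-tuple posint) (v : s.-tuple posint) i :
    tnth (vconcat (erefl (r + s)%N) u v) (lshift s i) = tnth u i.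
  by rewrite /vconcat tcast_id tnth_lshift.
have tr (u : r.-tuple posint) (v : s.-tuple posint) i :
    tnth (vconcat (erefl (r + s)%N) u v) (rshift r i) = tnth v i.
  by rewrite /vconcat tcast_id tnth_rshift.
split.
- move=> [u v] [/= uU vV] i; rewrite tnth_toR; case: (split_ordP i) => j ->.
    by rewrite tl -tnth_toR (le_trans (uU j))// hU cast_ord_id.
  by rewrite tr -tnth_toR (le_trans (vV j))// hV cast_ord_id.
- move=> [u v] [u' v'] _ _ /= E.
  have uv : vconcat (erefl (r + s)%N) u v = vconcat (erefl (r + s)%N) u' v' := E.
  congr (_, _); apply: eq_from_tnth => i.
    by rewrite -(tl u v) uv tl.
  by rewrite -(tr u v) uv tr.
- move=> x xX; exists ([tuple tnth x (lshift s i) | i < r], [tuple tnth x (rshift r i) | i < s]).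
    split=> i /=; rewrite tnth_toR tnth_mktuple -tnth_toR.
      by rewrite hU cast_ord_id; exact: xX.
    by rewrite hV cast_ord_id; exact: xX.
  apply: eq_from_tnth => i; case: (split_ordP i) => j ->.
    by rewrite tl tnth_mktuple.
  by rewrite tr tnth_mktuple.
Qed.

Lemma vmin_ge s (V : s.-tuple R) (L : R) : (0 < s)%N ->
  (forall i, L <= tnth V i) -> L <= vmin V.
Proof.
move=> s0 LV; rewrite /vmin; elim/big_ind: _ => //.
  by rewrite -nth0 -(tnth_nth _ _ (Ordinal s0)); exact: LV.
by move=> x y Lx Ly; rewrite le_min Lx.
Qed.

Lemma vprod_ge s (V : s.-tuple R) (L : R) : (0 < s)%N -> 1 <= L ->
  (forall i, L <= tnth V i) -> L <= vprod V.
Proof.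
move=> s0 L1 LV; rewrite /vprod (bigD1 (Ordinal s0))//=.
rewrite -[leLHS]mulr1 ler_pM ?(le_trans ler01)//.
by elim/big_rec: _ => // i x _ x1; rewrite -[leLHS]mulr1 ler_pM// (le_trans L1).
Qed.

Lemma vprod_ge1 s (V : s.-tuple R) : (forall i, 1 <= tnth V i) -> 1 <= vprod V.
Proof.
move=> LV; rewrite /vprod; elim/big_rec: _ => // i x _ x1.
by rewrite -[leLHS]mulr1 ler_pM.
Qed.

Lemma powRN_antimono (x y r : R) : 0 < x -> x <= y -> 0 <= r -> y `^ (- r) <= x `^ (- r).
Proof.
move=> x0 xy r0; have y0 := lt_le_trans x0 xy.
by rewrite !powR_expR_ln// ler_expR !mulNr lerN2 ler_wpM2l// ler_ln.
Qed.

Lemma norm_box_sum_le s (X : s.-tuple R) (phi : s.-tuple posint -> R) (B K : R) : 1 <= B ->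
  (forall i, tnth X i <= B) -> (forall x, box X x -> `|phi x| <= K) -> 0 <= K ->
  `|\sum_(x \in box X) phi x| <= B ^+ s * K.
Proof.
move=> B1 XB phiK K0.
have B0 := le_trans ler01 B1.
have NB : (Num.truncn B)%:R <= B by have /andP[] := Num.Theory.truncn_itv B0.
have XN i : tnth X i < (Num.truncn B).+1%:R.
  by rewrite (le_lt_trans (XB i))// Num.Theory.truncnS_gt.
rewrite (box_sumE _ XN) (le_trans (ler_norm_sum _ _ _))//.
apply: (@le_trans _ _ (\sum_(a : {ffun 'I_s -> 'I_(Num.truncn B)}) K)).
  rewrite big_mkcond /=; apply: ler_sum => a _; case: ifPn => // ha.
  by apply: phiK; have [hf _ _] := ffun_box_bij XN; exact: hf.
rewrite sumr_const card_ffun !card_ord -[leLHS]mulr_natl natrX ler_wpM2r//.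
by rewrite lerXn2r ?nnegrE.
Qed.

End boxes.

(** * Stability of the normalised box sums *)

Section family_estimates.
Context {R : realType} {k : nat}.
Hypothesis k_gt0 : (0 < k)%N.
Variables (alpha c D nu delta : R) (H : set (k.-tuple posint -> R)).
Variable cH : (k.-tuple posint -> R) -> R.
Hypothesis hH : is_family alpha c D nu delta H cH.
Implicit Types (h : k.-tuple posint -> R) (n : 'I_k -> nat) (I J K : {set 'I_k}).

Definition box_sum h n : R := \sum_(x \in box (toR (vec n) : k.-tuple R)) h x.

(** The function f of the sketch at the integer point with coordinates [n i + 1]. *)
Definition mean h n : R := box_sum h n / \prod_i (n i).+1%:R `^ alpha.

Lemma tnth_toR_vec n i : tnth (toR (vec n)) i = (n i).+1%:R :> R.
Proof. by rewrite tnth_toR tnth_vec. Qed.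

Lemma vprod_powR s (X : s.-tuple R) (a : R) : (forall i, 0 <= tnth X i) ->
  vprod X `^ a = \prod_i tnth X i `^ a.
Proof.
move=> X0; rewrite /vprod.
suff [] : (\prod_(i < s) tnth X i) `^ a = \prod_i tnth X i `^ a /\
  0 <= \prod_(i < s) tnth X i by [].
elim: (index_enum _) => [|i l [IH1 IH2]]; first by rewrite !big_nil powR1.
by rewrite !big_cons powRM// IH1 mulr_ge0.
Qed.

(** Only the coordinates in [J] may differ; [L] bounds these from below, and [B] bounds the common
    ones from above. *)
Definition close_on J n n' (L B : R) : Prop :=
  [/\ forall i, i \notin J -> n i = n' i, forall i, i \notin J -> (n i).+1%:R <= B &
      forall i, i \in J -> L <= (n i).+1%:R /\ L <= (n' i).+1%:R].

(** The condition on [B] and [L] is the range of u in (II). In the exponent, [D] stems from |u|^D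
    and [k] from the number of vectors u, at most B^k. *)
Definition mean_stable J (C : R) : Prop := 0 <= C /\
  forall h n n' L B, H h -> 1 <= L -> 1 <= B -> B <= L `^ nu -> close_on J n n' L B ->
    `|mean h n - mean h n'| <= C * (B `^ (D + k%:R) * L `^ (- delta)).

Lemma mean_approx_full : exists2 C : R, 0 <= C & forall h n L, H h -> 1 <= L ->
  (forall i, L <= (n i).+1%:R) -> `|mean h n - cH h| <= C * L `^ (- delta).
Proof.
have [_ [C hC]] := fam_I hH.
(* The constant in (I) comes without a sign. *)
exists `|C| => // h n L Hh L1 Ln.
have L0 : 0 < L := lt_le_trans ltr01 L1.
have V0 : 0 < vprod (toR (vec n)) `^ alpha :> R.
  rewrite powR_gt0// (lt_le_trans ltr01)// vprod_ge1// => i.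
  by rewrite tnth_toR_vec ler1n.
have eV : \prod_i (n i).+1%:R `^ alpha = vprod (toR (vec n)) `^ alpha :> R.
  rewrite vprod_powR => [|i]; last by rewrite tnth_toR_vec.
  by apply: eq_bigr => i _; rewrite tnth_toR_vec.
rewrite /mean eV -[cH h](mulfK (lt0r_neq0 V0)) -mulrBl normrM normfV (gtr0_norm V0).
rewrite ler_pdivrMr//.
have h1 i : 1 <= tnth (toR (vec n)) i :> R by rewrite tnth_toR_vec ler1n.
apply: le_trans (hC h Hh (toR (vec n)) h1) _.
apply: (@le_trans _ _ (`|C| * (vprod (toR (vec n)) `^ alpha * vmin (toR (vec n)) `^ (- delta)))).
  by rewrite ler_wpM2r ?ler_norm// mulr_ge0 ?powR_ge0.
rewrite -mulrA ler_wpM2l// mulrC ler_wpM2r ?(ltW V0)//.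
rewrite powRN_antimono// ?(ltW (fam_delta_gt0 hH))//.
by apply: vmin_ge => // i; rewrite tnth_toR_vec.
Qed.

Section block.
Variable J : {set 'I_k}.
Hypotheses (J0 : (0 < #|J|)%N) (JC0 : (0 < #|~: J|)%N).

Lemma block_cardE : (#|~: J| + #|J|)%N = k.
Proof. by rewrite addnC cardsC card_ord. Qed.

(** Lists the coordinates outside [J] first and those in [J] last. Since (II) fixes an initial block
    only, (III) with this reordering is what gives it for arbitrary [J]. *)
Definition block_coord (p : 'I_k) : 'I_k :=
  match fintype.split (cast_ord (esym block_cardE) p) with
  | inl a => enum_val a | inr b => enum_val b end.

Lemma block_coordl i : block_coord (cast_ord block_cardE (lshift #|J| i)) = enum_val i.
Proof. by rewrite /block_coord cast_ordK (unsplitK (inl i)). Qed.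

Lemma block_coordr i : block_coord (cast_ord block_cardE (rshift #|~: J| i)) = enum_val i.
Proof. by rewrite /block_coord cast_ordK (unsplitK (inr i)). Qed.

Lemma block_coord_inj : injective block_coord.
Proof.
have cs p : exists q, p = cast_ord block_cardE q.
  by exists (cast_ord (esym block_cardE) p); rewrite cast_ordKV.
move=> p q; have [{}p ->] := cs p; have [{}q ->] := cs q.
have disj (a : 'I_(#|~: J|)) (b : 'I_(#|J|)) : enum_val a <> enum_val b.
  move=> ab; have := enum_valP a; rewrite ab inE => /negP; apply.
  exact: enum_valP.
case: (split_ordP p) => a ->; case: (split_ordP q) => b ->;
  rewrite ?block_coordl ?block_coordr.
- by move=> /enum_val_inj ->.
- by move=> /disj.
- by move=> /esym/disj.
- by move=> /enum_val_inj ->.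
Qed.

(** The place of a coordinate in that list; an inverse, because [permute] reads argument i of h at
    the place sigma i. *)
Definition block_perm : 'S_k := ((perm block_coord_inj)^-1)%g.

Lemma block_coordK i : block_coord (block_perm i) = i.
Proof. by rewrite -(permE block_coord_inj) permKV. Qed.

Lemma block_box_sum h n : box_sum h n =
  \sum_(u \in box ([tuple (n (enum_val i)).+1%:R | i < #|~: J|] : (#|~: J|).-tuple R))
  \sum_(v \in box ([tuple (n (enum_val i)).+1%:R | i < #|J|] : #|J|.-tuple R))
    permute block_perm h (vconcat block_cardE u v).
Proof.
rewrite /box_sum (@box_sum_permute _ _ _
  [tuple (n (block_coord i)).+1%:R | i < k] block_perm); last first.
  by move=> i; rewrite tnth_toR_vec tnth_mktuple block_coordK.
by apply: box_sum_concat => i; rewrite !tnth_mktuple ?block_coordl ?block_coordr.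
Qed.

Lemma block_prod (f : 'I_k -> R) : \prod_i f i =
  (\prod_(i < #|~: J|) f (enum_val i)) * \prod_(i < #|J|) f (enum_val i).
Proof.
rewrite -!(big_enum_val f) mulrC.
rewrite (bigID (mem J))/=; congr (_ * _); apply: eq_bigl => i.
by rewrite inE.
Qed.

(** Both means are compared with the same quantity: the sum of c_{h,r}(u) over the small block,
    divided by that block's product to the power alpha. It does not involve the coordinates in
    [J]. *)
Lemma mean_stable_block : exists C, mean_stable J C.
Proof.
have [cHr [cHr0 [C hC]]] := fam_II hH block_cardE JC0 J0.
have D0 := fam_D_ge0 hH; have d0 := ltW (fam_delta_gt0 hH).
have /andP[nu0 nu1] := fam_nu hH.
have a0 := ltW (fam_alpha_gt0 hH).
pose U n : (#|~: J|).-tuple R := [tuple (n (enum_val i)).+1%:R | i < #|~: J|].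
pose V n : #|J|.-tuple R := [tuple (n (enum_val i)).+1%:R | i < #|J|].
pose A h n := \sum_(u \in box (U n)) cHr (permute block_perm h) u.
have main h n L B : H h -> 1 <= L -> 1 <= B -> B <= L `^ nu ->
    (forall i, i \notin J -> (n i).+1%:R <= B) -> (forall i, i \in J -> L <= (n i).+1%:R) ->
    `|mean h n - A h n / vprod (U n) `^ alpha| <= `|C| * (B `^ (D + k%:R) * L `^ (- delta)).
  move=> Hh L1 B1 BL nB nL.
  have L0 := lt_le_trans ltr01 L1; have B0 := lt_le_trans ltr01 B1.
  have Hs := fam_III hH block_perm Hh.
  have UB i : tnth (U n) i <= B.
    by rewrite tnth_mktuple nB//; have := enum_valP i; rewrite inE.
  have LV i : L <= tnth (V n) i by rewrite tnth_mktuple nL//; exact: enum_valP.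
  have V1 i : 1 <= tnth (V n) i by rewrite (le_trans L1).
  have U1 i : 1 <= tnth (U n) i by rewrite tnth_mktuple ler1n.
  have vV : L <= vprod (V n) by exact: vprod_ge.
  have V0 : 0 < vprod (V n) `^ alpha by rewrite powR_gt0// (lt_le_trans L0).
  have vU1 : 1 <= vprod (U n) `^ alpha.
    rewrite powR_expR_ln; last by rewrite (lt_le_trans ltr01)// vprod_ge1.
    by rewrite -[leLHS]expR0 ler_expR mulr_ge0// ln_ge0// vprod_ge1.
  have U0 := lt_le_trans ltr01 vU1.
  have eP : \prod_i (n i).+1%:R `^ alpha = vprod (U n) `^ alpha * vprod (V n) `^ alpha :> R.
    rewrite block_prod !vprod_powR => [|i|i]; rewrite ?(le_trans ler01)//.
    by congr (_ * _); apply: eq_bigr => i _; rewrite tnth_mktuple.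
  have eS : box_sum h n - A h n * vprod (V n) `^ alpha = \sum_(u \in box (U n))
      (\sum_(v \in box (V n)) permute block_perm h (vconcat block_cardE u v)
        - cHr (permute block_perm h) u * vprod (V n) `^ alpha).
    rewrite block_box_sum -/(U n) -/(V n) /A mulr_fsuml.
    by rewrite !fsbig_finite ?sumrB//; exact: finite_box.
  have vm u : box (U n) u -> (vmax u)%:R <= B.
    move=> uU; have NB : (Num.truncn B)%:R <= B.
      by have /andP[] := Num.Theory.truncn_itv (ltW B0).
    apply: le_trans NB; rewrite ler_nat; apply/bigmax_leqP => i _.
    rewrite Num.Theory.truncn_ge_nat ?(ltW B0)//.
    by rewrite -tnth_toR (le_trans (uU i)).
  (* There are at most B^r vectors u, with r the size of the complement of [J], and (II) applies to
     each because |u| <= B <= L^nu. *)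
  have est : `|box_sum h n - A h n * vprod (V n) `^ alpha| <=
      B ^+ #|~: J| * (`|C| * (vprod (V n) `^ alpha * B `^ D * L `^ (- delta))).
    rewrite eS; apply: norm_box_sum_le => //; last first.
      by rewrite !mulr_ge0 ?powR_ge0.
    move=> u uU; have uB := vm u uU.
    have cond : (vmax u)%:R <= vprod (V n) `^ nu.
      rewrite (le_trans uB)// (le_trans BL)// ge0_ler_powR ?nnegrE ?(ltW nu0)// ?(ltW L0)//.
      by rewrite (le_trans (ltW L0)).
    apply: le_trans (hC _ Hs _ V1 _ cond) _.
    apply: (@le_trans _ _ (`|C| * (vprod (V n) `^ alpha * (vmax u)%:R `^ D * vmin (V n) `^ (- delta)))).
      by rewrite ler_wpM2r ?ler_norm// !mulr_ge0 ?powR_ge0.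
    rewrite ler_wpM2l// ler_pM ?mulr_ge0 ?powR_ge0//.
      by rewrite ler_wpM2l ?powR_ge0// ge0_ler_powR ?nnegrE ?(ltW B0)// ler0n.
    by rewrite powRN_antimono//; exact: vmin_ge.
  rewrite /mean eP.
  rewrite (_ : _ - _ = (box_sum h n - A h n * vprod (V n) `^ alpha) /
    (vprod (U n) `^ alpha * vprod (V n) `^ alpha)); last first.
    by field; rewrite !lt0r_neq0.
  rewrite normrM normfV (gtr0_norm (mulr_gt0 U0 V0)) ler_pdivrMr ?mulr_gt0//.
  apply: le_trans est _.
  have BB : B ^+ #|~: J| <= B `^ k%:R.
    rewrite powR_mulrn ?(ltW B0)// ler_weXn2l//.
    by rewrite -[X in (_ <= X)%N]block_cardE leq_addr.
  rewrite powR_sum_exp//.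
  rewrite [leLHS](_ : _ = B ^+ #|~: J| * 1 * (`|C| * (vprod (V n) `^ alpha * B `^ D * L `^ (- delta)))); last by rewrite mulr1.
  rewrite [leRHS](_ : _ = B `^ k%:R * vprod (U n) `^ alpha * (`|C| * (vprod (V n) `^ alpha * B `^ D * L `^ (- delta)))); last by ring.
  rewrite ler_wpM2r ?mulr_ge0 ?powR_ge0//.
  by rewrite ler_pM// exprn_ge0// ltW.
exists (`|C| + `|C|); split=> [|h n n' L B Hh L1 B1 BL [nn nB nL]]; first exact: addr_ge0.
have UU : U n = U n'.
  apply: eq_from_tnth => i; rewrite !tnth_mktuple nn//.
  by have := enum_valP i; rewrite inE.
have m1 : `|mean h n - A h n / vprod (U n) `^ alpha| <= _ :=
  main h n L B Hh L1 B1 BL nB (fun i iJ => (nL i iJ).1).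
have m2 : `|mean h n' - A h n' / vprod (U n') `^ alpha| <= `|C| * (B `^ (D + k%:R) * L `^ (- delta)).
  apply: main => // i iJ; first by rewrite -nn// nB.
  by have [] := nL i iJ.
rewrite /A -UU -/(A h n) in m2.
rewrite -(subrK (A h n / vprod (U n) `^ alpha) (mean h n)) -addrA mulrDl.
by rewrite (le_trans (ler_normD _ _))// lerD// distrC.
Qed.

End block.

(** (II) requires both blocks to be nonempty. If [J] is empty nothing moves; if [J] is everything,
    (I) compares both means with c_h. *)
Lemma mean_stable_exists J : exists C, mean_stable J C.
Proof.
have [/eqP|J0] := posnP #|J|.
  rewrite cards_eq0 => /eqP ->; exists 0; split=> // h n n' L B _ _ _ _ [nn _ _].
  have -> : n = n' by apply/funext => i; rewrite nn// inE.
  by rewrite subrr normr0 mul0r.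
have [/eqP|JC0] := posnP #|~: J|; last exact: mean_stable_block.
rewrite cards_eq0 => /eqP JC.
have JT i : i \in J by have := finset.in_set0 i; rewrite -JC inE => /negbFE.
have [C C0 hC] := mean_approx_full.
exists (C + C); split=> [|h n n' L B Hh L1 B1 BL [nn nB nL]]; first exact: addr_ge0.
have h1 := hC h n L Hh L1 (fun i => (nL i (JT i)).1).
have h2 := hC h n' L Hh L1 (fun i => (nL i (JT i)).2).
apply: (@le_trans _ _ ((C + C) * L `^ (- delta))).
  rewrite -(subrK (cH h) (mean h n)) -addrA mulrDl.
  by rewrite (le_trans (ler_normD _ _))// lerD// distrC.
rewrite ler_wpM2l ?addr_ge0// ler_peMl ?powR_ge0//.
rewrite powR_expR_ln ?(lt_le_trans ltr01)// -[leLHS]expR0 ler_expR.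
by rewrite mulr_ge0 ?ln_ge0// addr_ge0// (fam_D_ge0 hH).
Qed.

Lemma mean_stable_uniform : exists C, forall J, mean_stable J C.
Proof.
have [C hC] := choice mean_stable_exists.
exists (\sum_J C J) => J; split=> [|h n n' L B Hh L1 B1 BL nn].
  by apply: sumr_ge0 => I _; have [] := hC I.
have [C0 hJ] := hC J.
rewrite (le_trans (hJ h n n' L B Hh L1 B1 BL nn))// ler_wpM2r ?mulr_ge0 ?powR_ge0//.
rewrite (bigD1 J)//= lerDl; apply: sumr_ge0 => I _; by have [] := hC I.
Qed.

End family_estimates.

(** * Limits of the normalised box sums and Moebius inversion *)

Section alternating_sums.
Context {T : finType}.
Implicit Types (K I : {set T}) (j : T).

Definition toggle j K : {set T} := if j \in K then (K :\ j)%SET else (j |: K)%SET.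

Lemma in_toggle j K i : (i \in toggle j K) = if i == j then j \notin K else i \in K.
Proof.
rewrite /toggle; case: ifPn => jK; rewrite !inE; case: eqVneq => [->|] //=.
Qed.

Lemma toggleK j : involutive (toggle j).
Proof.
move=> K; apply/setP => i; rewrite !in_toggle eqxx.
by case: eqVneq => [->|//]; rewrite negbK.
Qed.

Lemma odd_card_toggle j K : odd #|toggle j K| = ~~ odd #|K|.
Proof.
rewrite /toggle; case: ifPn => jK; last by rewrite cardsU1 jK.
by rewrite (cardsD1 j K) jK /= negbK.
Qed.

(** Toggling [j] reverses the sign and preserves the rest, so the sum is its own negative. *)
Lemma alternating_sum_eq0 (R : realDomainType) (P : pred {set T}) (phi : {set T} -> R) j :
  (forall K, P (toggle j K) = P K) -> (forall K, phi (toggle j K) = phi K) ->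
  \sum_(K | P K) (-1) ^+ #|K| * phi K = 0.
Proof.
move=> hP hphi; set S := \sum_(_ | _) _.
suff : S = - S by move=> ?; lra.
rewrite {1}/S (reindex_inj (inv_inj (toggleK j))) /= -sumrN.
apply: eq_big => [K|K _]; first exact: hP.
rewrite hphi -[in LHS]signr_odd odd_card_toggle -[in RHS]signr_odd.
by case: odd; rewrite /= ?expr0 ?expr1; ring.
Qed.

(** After exchanging the sums, [phi K] is multiplied by an alternating sum over all I containing K,
    which vanishes by toggling some j outside K, unless K is the full set. *)
Lemma mobius_set_sum (R : realDomainType) (phi : {set T} -> R) :
  \sum_(I : {set T}) \sum_(K : {set T} | K \subset I) (-1) ^+ (#|I| + #|K|) * phi K =
  phi [set: T]%SET.
Proof.
rewrite (exchange_big_dep predT)//= (bigD1 [set: T]%SET)//=.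
rewrite [X in _ + X]big1 ?addr0 => [|K KT].
  rewrite (bigD1 [set: T]%SET) ?subxx//= big1 => [|I].
    by rewrite addr0 addnn -mul2n exprM sqrrN expr1n expr1n mul1r.
  by rewrite finset.subTset => /andP[/eqP -> /eqP].
have [j jK] : exists j, j \notin K.
  by apply/existsP; rewrite -negb_forall; apply: contra KT => /forallP h; apply/eqP/setP => i; rewrite h !inE.
under eq_bigr do rewrite exprD -mulrA.
apply: (alternating_sum_eq0 (phi := fun=> (-1) ^+ #|K| * phi K) (j := j)) => // I.
by apply/idP/idP => /fintype.subsetP h; apply/fintype.subsetP => i iK;
  have := h i iK; rewrite in_toggle; case: eqVneq => // ij; rewrite -ij iK in jK.
Qed.

End alternating_sums.

(** * Limits of the means in some coordinates, and their Moebius components *)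

Section mean_limits.
Context {R : realType} {k : nat}.
Hypothesis k_gt0 : (0 < k)%N.
Variables (alpha c D nu delta : R) (H : set (k.-tuple posint -> R)).
Variable cH : (k.-tuple posint -> R) -> R.
Hypothesis hH : is_family alpha c D nu delta H cH.
Implicit Types (h : k.-tuple posint -> R) (n : 'I_k -> nat) (I J K : {set 'I_k}).

Local Notation mean := (mean alpha).

Definition limit_at (u : nat -> R) (a : R) : Prop :=
  forall e, 0 < e -> exists N, forall M, (N <= M)%N -> `|u M - a| <= e.

Lemma limit_at_bound (u v : nat -> R) (a b B : R) : limit_at u a -> limit_at v b ->
  (exists N, forall M, (N <= M)%N -> `|u M - v M| <= B) -> `|a - b| <= B.
Proof.
move=> ua vb [N hN]; apply/ler_addgt0Pr => e e0.
have e2 : 0 < e / 2 by rewrite divr_gt0.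
have [N1 h1] := ua _ e2; have [N2 h2] := vb _ e2.
pose M := maxn N (maxn N1 N2).
have {}hN := hN M (leq_maxl _ _).
have {}h1 : `|u M - a| <= e / 2 by apply: h1; rewrite /M !leq_max leqnn !orbT.
have {}h2 : `|v M - b| <= e / 2 by apply: h2; rewrite /M !leq_max leqnn !orbT.
rewrite (_ : a - b = - (u M - a) + ((u M - v M) + (v M - b))); last by ring.
rewrite (le_trans (ler_normD _ _))// normrN.
have := ler_normD (u M - v M) (v M - b); lra.
Qed.

Lemma limit_at_cst (a : R) : limit_at (fun=> a) a.
Proof. by move=> e e0; exists 0%N => M _; rewrite subrr normr0 ltW. Qed.

Lemma limit_at_unique (u : nat -> R) a b : limit_at u a -> limit_at u b -> a = b.
Proof.
move=> ua ub; apply/eqP; rewrite -subr_eq0 -normr_le0.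
by apply: limit_at_bound ua ub _; exists 0%N => M _; rewrite subrr normr0.
Qed.

Lemma powR_eventually_ge (B r : R) : 0 < r ->
  exists N, forall M, (N <= M)%N -> B <= M.+1%:R `^ r.
Proof.
move=> r0; pose y := (`|B| + 1) `^ r^-1.
exists (Num.truncn y) => M NM.
have y0 : 0 <= y by exact: powR_ge0.
have yM : y <= M.+1%:R.
  by rewrite (le_trans (ltW (Num.Theory.truncnS_gt y)))// ler_nat ltnS.
apply: (@le_trans _ _ (y `^ r)).
  rewrite -powRrM mulVf ?gt_eqF// powRr1 ?addr_ge0//.
  by rewrite (le_trans (ler_norm _))// lerDl.
by rewrite ge0_ler_powR ?nnegrE// ltW.
Qed.

Lemma powRN_eventually_le (B r e : R) : 0 < r -> 0 < e ->
  exists N, forall M, (N <= M)%N -> B * M.+1%:R `^ (- r) <= e.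
Proof.
move=> r0 e0; have [N hN] := powR_eventually_ge (B / e) r0.
exists N => M NM; rewrite powRN ler_pdivrMr ?powR_gt0//.
by rewrite mulrC -ler_pdivrMr// hN.
Qed.

Definition restr K (M : nat) n : 'I_k -> nat := fun i => if i \in K then n i else M.

(** The f_K of the sketch, all coordinates outside [K] tending to infinity together. For h in [H]
    the limit exists, so the default 0 is harmless. *)
Definition mean_lim h K n : R := xget 0 [set a | limit_at (fun M => mean h (restr K M n)) a].

(** Stability for the complement of [K], with the fixed coordinates bounded by a constant, makes the
    sequence Cauchy with a rate. *)
Lemma mean_limP h K n : H h ->
  limit_at (fun M => mean h (restr K M n)) (mean_lim h K n).
Proof.
move=> Hh; apply: (xgetPex 0 (P := [set a | limit_at (fun M => mean h (restr K M n)) a])).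
have [C hC] := mean_stable_uniform k_gt0 hH.
have [C0 {}hC] := hC (~: K)%SET.
have /andP[nu0 _] := fam_nu hH; have d0 := fam_delta_gt0 hH.
pose B : R := (\max_(i < k) n i).+1%:R.
have B1 : 1 <= B by rewrite ler1n.
(* From [N0] on the condition B <= L^nu holds; the sequence is shifted by [N0] because [cauchy_rate]
   asks for all positive indices. *)
have [N0 hN0] := powR_eventually_ge B nu0.
pose E := C * B `^ (D + k%:R).
pose eps N := E * (N + N0).+1%:R `^ (- delta).
have [a ha] : exists a, forall N, (0 < N)%N ->
    `|mean h (restr K (N + N0) n) - a| <= eps N.
  apply: (@cauchy_rate _ (fun N => mean h (restr K (N + N0) n))) => N M /andP[_ NM].
  rewrite /eps /E -mulrA; apply: hC => //.
  - by rewrite ler1n.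
  - by apply: hN0; rewrite leq_addl.
  - split=> i; rewrite ?inE ?negbK /restr.
    + by move=> ->.
    + by move=> ->; rewrite ler_nat ltnS; exact: leq_bigmax.
    + by move=> /negbTE ->; rewrite !ler_nat !ltnS !leq_add2r leqnn; split.
exists a => e e0; have [N1 hN1] := powRN_eventually_le E d0 e0.
exists (maxn N0.+1 N1) => M; rewrite geq_max => /andP[M0 M1].
have -> : (M = (M - N0) + N0)%N by rewrite subnK// ltnW.
rewrite (le_trans (ha _ _)) ?subn_gt0// /eps subnK ?(ltnW M0)//.
exact: hN1.
Qed.

Lemma mean_lim_setT h n : H h -> mean_lim h [set: 'I_k]%SET n = mean h n.
Proof.
move=> Hh; apply: limit_at_unique (mean_limP _ _ Hh) _.
rewrite (_ : (fun M => _) = fun=> mean h n); first exact: limit_at_cst.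
by apply/funext => M; congr (mean h _); apply/funext => i; rewrite /restr inE.
Qed.

Lemma mean_lim_set0 h n : H h -> mean_lim h finset.set0 n = cH h.
Proof.
move=> Hh; apply: limit_at_unique (mean_limP _ _ Hh) _ => e e0.
have [C C0 hC] := mean_approx_full k_gt0 hH.
have [N hN] := powRN_eventually_le C (fam_delta_gt0 hH) e0.
exists N => M NM; rewrite (le_trans _ (hN M NM))//.
apply: hC => //; first by rewrite ler1n.
by move=> i; rewrite /restr inE.
Qed.

Lemma mean_lim_local h K n n' : (forall i, i \in K -> n i = n' i) ->
  mean_lim h K n = mean_lim h K n'.
Proof.
move=> nn; rewrite /mean_lim.
suff -> : (fun M => mean h (restr K M n)) = (fun M => mean h (restr K M n')) by [].
apply/funext => M; suff -> : restr K M n = restr K M n' by [].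
apply/funext => i; rewrite /restr.
by case: ifPn => // /nn.
Qed.

(** Stability passed to the limit. Coordinates outside [K] become arbitrarily large, so the moving
    block is [J] together with the complement of [K]. *)
Lemma mean_lim_stable : exists2 C : R, 0 <= C & forall h K J n L B, H h ->
  1 <= L -> 1 <= B -> B <= L `^ nu ->
  (forall i, i \in K -> i \notin J -> (n i).+1%:R <= B) ->
  (forall i, i \in K -> i \in J -> L <= (n i).+1%:R) ->
  `|mean_lim h K n - mean_lim h (K :\: J)%SET n| <= C * (B `^ (D + k%:R) * L `^ (- delta)).
Proof.
have [C hC] := mean_stable_uniform k_gt0 hH.
have [C0 _] := hC finset.set0.
exists C => // h K J n L B Hh L1 B1 BL nB nL.
apply: limit_at_bound (mean_limP K n Hh) (mean_limP (K :\: J)%SET n Hh) _.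
exists (Num.truncn L) => M LM.
have {}LM : L <= M.+1%:R.
  by rewrite (le_trans (ltW (Num.Theory.truncnS_gt L)))// ler_nat ltnS.
apply: (hC (J :|: ~: K)%SET).2 => //; split=> i; rewrite /restr ?inE.
- by rewrite negb_or negbK => /andP[-> ->].
- by rewrite negb_or negbK => /andP[iJ iK]; rewrite iK nB.
- case: (boolP (i \in K)) => [iK|_ _]; last by rewrite andbF.
  by rewrite orbF => iJ; rewrite iJ /=; split => //; exact: nL.
Qed.

(** The g_I of the sketch. *)
Definition component h I n : R :=
  \sum_(K : {set 'I_k} | K \subset I) (-1) ^+ (#|I| + #|K|) * mean_lim h K n.

Lemma sum_component h n : H h -> \sum_I component h I n = mean h n.
Proof. by move=> Hh; rewrite -(mean_lim_setT n Hh) -(mobius_set_sum (fun K => mean_lim h K n)). Qed.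

Lemma component_set0 h n : H h -> component h finset.set0 n = cH h.
Proof.
move=> Hh; rewrite /component (big_pred1 finset.set0) => [|K].
  by rewrite cards0 mean_lim_set0// mul1r.
by rewrite finset.subset0.
Qed.

Lemma component_local h I n n' : (forall i, i \in I -> n i = n' i) ->
  component h I n = component h I n'.
Proof.
move=> nn; rewrite /component; apply: eq_bigr => K /fintype.subsetP KI.
by rewrite (@mean_lim_local h K n n') // => i /KI; exact: nn.
Qed.

(** The subtracted terms sum to 0, as toggling j in [J] does not change K \ J. What remains are
    differences that [mean_lim_stable] bounds. *)
Lemma component_subtract h I J n j : j \in I -> j \in J ->
  component h I n = \sum_(K : {set 'I_k} | K \subset I)
    (-1) ^+ (#|I| + #|K|) * (mean_lim h K n - mean_lim h (K :\: J)%SET n).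
Proof.
move=> jI jJ; under [RHS]eq_bigr do rewrite mulrBr.
rewrite sumrB -[LHS]subr0; congr (_ - _); apply/esym.
under eq_bigr do rewrite exprD -mulrA mulrCA.
apply: (alternating_sum_eq0 (phi := fun K : {set 'I_k} => (-1) ^+ #|I| * mean_lim h (K :\: J)%SET n)
  (j := j)) => K.
  apply/idP/idP => /fintype.subsetP h'; apply/fintype.subsetP => i;
  have := h' i; rewrite in_toggle; case: eqVneq => [->//|_]; exact.
congr (_ * mean_lim h _ n); apply/setP => i; rewrite !inE in_toggle.
by case: eqVneq => // ->; rewrite jJ.
Qed.

(* Pigeonhole: one of the scales [T^(kappa^m)], [m <= k], separates the coordinates in [I]
   into large ones (set [J]) and much smaller ones. *)
Lemma scale_gap I n (kappa : R) : 0 < kappa <= 1 -> I != finset.set0 ->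
  let T : R := (\max_(i in I) (n i).+1)%:R in
  exists (J : {set 'I_k}) (j : 'I_k) (m : nat),
    [/\ j \in I, j \in J, (m <= k)%N,
      forall i, i \in J -> T `^ (kappa ^+ m) <= (n i).+1%:R &
      forall i, i \in I -> i \notin J -> (n i).+1%:R <= T `^ (kappa ^+ m.+1)].
Proof.
move=> /andP[k0 k1] I0 T.
have [j jI Tj] : exists2 j, j \in I & T = (n j).+1%:R.
  have /(eq_bigmax_cond (fun i => (n i).+1))[j jI Tj] : (0 < #|I|)%N by rewrite card_gt0.
  by exists j => //; rewrite /T Tj.
have T1 : 1 <= T by rewrite Tj ler1n.
pose J m := [set i in I | T `^ (kappa ^+ m) <= (n i).+1%:R]%SET.
have JS m : J m \subset J m.+1.
  apply/fintype.subsetP => i; rewrite !inE => /andP[-> /=]; apply: le_trans.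
  by rewrite ler_powR// exprS ler_piMl// exprn_ge0// ltW.
have jJ m : j \in J m.
  rewrite inE jI /= -Tj -[leRHS]powRr1 ?(le_trans ler01)// ler_powR//.
  by rewrite exprn_ile1// ltW.
have [m mk Jm] : exists2 m, (m <= k)%N & J m = J m.+1.
  apply/not_exists2P => hm.
  suff h m : (m <= k.+1)%N -> (m < #|J m|)%N.
    have := h k.+1 (leqnn _); have := max_card (mem (J k.+1)).
    by rewrite card_ord => h1 h2; have := leq_trans h2 h1; rewrite ltnNge leqnSn.
  elim: m => [_|m IH mk]; first by apply/card_gt0P; exists j.
  rewrite (leq_ltn_trans (IH (ltnW mk)))//; apply: proper_card.
  rewrite finset.properEneq JS andbT; apply/eqP => e; have [] := hm m; first by [].
  by [].
exists (J m), j, m; split=> // i; first by rewrite inE => /andP[].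
move=> iI; rewrite Jm inE iI /= -ltNge; exact: ltW.
Qed.

(** [scale_gap] provides a block [J] to which [mean_lim_stable] applies with L = T^(kappa^m) and B =
    T^(kappa^(m+1)). The saving in the largest entry T is then shared among the coordinates in I. *)
Lemma component_bound : exists2 theta : R, 0 < theta & exists2 C : R, 0 <= C &
  forall h I n, H h -> `|component h I n| <= C * \prod_(i in I) (n i).+1%:R `^ (- theta).
Proof.
have [C C0 hC] := mean_lim_stable.
have /andP[nu0 nu1] := fam_nu hH; have d0 := fam_delta_gt0 hH.
have D0 := fam_D_ge0 hH; have c0 := ltW (fam_c_gt0 hH).
have kR : 0 < k%:R :> R by rewrite ltr0n.
pose E := D + k%:R.
have E0 : 0 < E by rewrite ltr_wpDl.
(* The bound [nu] ensures B <= L^nu; the other one makes B^E at most L^(delta/2), so half of [delta]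
   survives. *)
pose kappa := Num.min nu (delta / (2 * E)).
have ka0 : 0 < kappa by rewrite lt_min nu0 divr_gt0// mulr_gt0.
have ka1 : kappa <= 1 by rewrite ge_min nu1.
have kaE : kappa * E <= delta / 2.
  have : kappa <= delta / (2 * E) by rewrite ge_min lexx orbT.
  by rewrite ler_pdivlMr ?mulr_gt0//; lra.
(* The exponent saved at scale m is at least kappa^m delta/2, which is smallest for m = k. *)
pose eta0 := kappa ^+ k * (delta / 2).
have eta00 : 0 < eta0 by rewrite mulr_gt0 ?exprn_gt0// divr_gt0.
exists (eta0 / k%:R); first by rewrite divr_gt0.
(* [c] covers the empty I, whose component is c_h; otherwise each subset K contributes at most C
   T^(-eta0). *)
exists (c + #|{set 'I_k}|%:R * C) => [|h I n Hh]; first by rewrite addr_ge0 ?mulr_ge0.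
have [->|I0] := eqVneq I finset.set0.
  rewrite component_set0// big_set0 mulr1.
  have [hc _] := fam_I hH; have /andP[h1 h2] := hc h Hh.
  by rewrite ger0_norm// (le_trans h2)// lerDl mulr_ge0.
have ka01 : 0 < kappa <= 1 by rewrite ka0.
have [J [j [m [jI jJ mk nL nB]]]] := scale_gap n ka01 I0.
set T : R := (\max_(i in I) (n i).+1)%:R in nL nB.
have nT i : i \in I -> (n i).+1%:R <= T.
  by move=> iI; rewrite ler_nat; apply: (leq_bigmax_cond (F := fun i => (n i).+1)).
have T1 : 1 <= T by rewrite (le_trans _ (nT j jI))// ler1n.
have T0 := lt_le_trans ltr01 T1.
have powT1 a : 0 <= a -> 1 <= T `^ a by move=> a0; rewrite -[leLHS](powRr0 T) ler_powR.
have kam a : 0 <= kappa ^+ a by rewrite exprn_ge0// ltW.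
have step K : K \subset I -> `|mean_lim h K n - mean_lim h (K :\: J)%SET n| <= C * T `^ (- eta0).
  move=> /fintype.subsetP KI.
  apply: le_trans (hC h K J n (T `^ (kappa ^+ m)) (T `^ (kappa ^+ m.+1)) Hh _ _ _ _ _) _.
  - exact: powT1.
  - exact: powT1.
  - rewrite -powRrM ler_powR// exprSr ler_wpM2l//.
    by rewrite ge_min lexx.
  - by move=> i iK; apply: nB; exact: KI.
  - by move=> i _; exact: nL.
  rewrite ler_wpM2l// -!powRrM -powR_sum_exp// ler_powR// -/E.
  have kk : kappa ^+ k <= kappa ^+ m by rewrite ler_wiXn2l// ltW.
  have h1 : kappa ^+ m * (kappa * E) <= kappa ^+ m * (delta / 2) by rewrite ler_wpM2l.
  have h2 : kappa ^+ k * (delta / 2) <= kappa ^+ m * (delta / 2).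
    by rewrite ler_wpM2r// divr_ge0// ltW.
  by rewrite exprSr /eta0; lra.
(* There are at most k factors, each at least T^(-eta0/k). *)
have prodT : T `^ (- eta0) <= \prod_(i in I) (n i).+1%:R `^ (- (eta0 / k%:R)).
  apply: (@le_trans _ _ (\prod_(i in I) T `^ (- (eta0 / k%:R)))).
    rewrite prodr_const -powR_mulrn ?powR_ge0// -powRrM ler_powR// mulNr lerN2.
    rewrite -mulrA ler_piMr ?(ltW eta00)// mulrC ler_pdivrMr// mul1r ler_nat.
    by rewrite -[X in (_ <= X)%N]card_ord; exact: max_card.
  apply: ler_prod => i iI; rewrite powR_ge0 powRN_antimono ?nT//.
  by rewrite divr_ge0// ltW.
apply: (@le_trans _ _ (#|{set 'I_k}|%:R * C * T `^ (- eta0))).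
  rewrite (component_subtract _ _ jI jJ) (le_trans (ler_norm_sum _ _ _))//.
  apply: (@le_trans _ _ (\sum_(K : {set 'I_k}) C * T `^ (- eta0))).
    rewrite big_mkcond /=; apply: ler_sum => K _; case: ifPn => KI.
      by rewrite normrM normrX normrN1 expr1n mul1r; exact: step.
    by rewrite mulr_ge0// powR_ge0.
  by rewrite sumr_const -[leRHS]mulrA mulr_natl.
by rewrite ler_pM ?mulr_ge0 ?powR_ge0// lerDr.
Qed.

End mean_limits.

(** * The moments of the unit cube *)

Section cube_moments.
Context {R : realType}.
Local Notation leb := (@lebesgue_measure R).

(** With the indicator in the integrand, the cube becomes a product of functions on the whole line,
    to which Tonelli applies one coordinate at a time. *)
Definition unit_power b (x : R) : R := x ^+ b * \1_(`[0, 1]) x.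

Lemma unit_power_ge0 b x : 0 <= unit_power b x.
Proof.
rewrite /unit_power indicE; case: (boolP (x \in _)) => [|_]; last by rewrite mulr0.
by rewrite inE /= in_itv /= mulr1 => /andP[x0 _]; rewrite exprn_ge0.
Qed.

Lemma measurable_unit_power b : measurable_fun setT (unit_power b).
Proof.
apply: measurable_funM.
  by apply: continuous_measurable_fun; exact: exprn_continuous.
exact: measurable_indic.
Qed.

Lemma integral_unit_power b : (\int[leb]_x (unit_power b x)%:E)%E = (b.+1%:R^-1)%:E.
Proof.
transitivity (\int[leb]_(x in `[0%R, 1%R]) (x ^+ b)%:E)%E.
  rewrite [RHS]integral_mkcond; apply: eq_integral => x _.
  rewrite patchE /unit_power indicE; case: (x \in _) => /=; first by rewrite mulr1.
  by rewrite mulr0.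
pose F x : R := b.+1%:R^-1 * x ^+ b.+1.
have cF : continuous F.
  move=> x; apply: cvgM; first exact: cvg_cst.
  exact: exprn_continuous.
rewrite (@continuous_FTC2 _ (fun x => x ^+ b) F)//.
- by rewrite /F expr1n expr0n /= mulr0 mulr1 sube0.
- by apply: continuous_subspaceT; exact: exprn_continuous.
- split.
  + by move=> x _; apply: derivableM => //; exact: exprn_derivable.
  + by apply: cvg_at_right_filter; exact: cF.
  + by apply: cvg_at_left_filter; exact: cF.
- move=> x _; rewrite /F derive1E deriveM//; last exact: exprn_derivable.
  by rewrite derive_cst scaler0 addr0 -derive1E exp_derive1 /= scalerA mulVf ?scale1r//.
Qed.

Lemma measurable_prod_unit_power n (b : 'I_n -> nat) :
  measurable_fun setT ((fun t => (\prod_i unit_power (b i) (tnth t i))%:E) :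
    n.-tuple (measurableTypeR R) -> \bar R).
Proof.
apply/measurable_EFinP; apply: measurable_prod => i _.
apply: (measurableT_comp (measurable_unit_power (b i))).
exact: measurable_tnth.
Qed.

(** Induction on [n]: the measure is the image under [cons_pair] of a product measure, so Tonelli
    splits off the first coordinate; for n = 0 it is a Dirac mass. *)
Lemma integral_prod_unit_power n (b : 'I_n -> nat) :
  (\int[lebesgue_tuple n]_t (\prod_i unit_power (b i) (tnth t i))%:E)%E =
  (\prod_i (b i).+1%:R^-1)%:E.
Proof.
elim: n b => [|n IH] b.
  rewrite integral_dirac//; last exact: measurable_prod_unit_power.
  by rewrite !big_ord0 diracT mul1e.
have m1 := @measurable_cons_pair _ (measurableTypeR R) n.
transitivity (\int[pushforward (leb \x lebesgue_tuple n)%E (@cons_pair _ (measurableTypeR R) n)]_t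
    (\prod_i unit_power (b i) (tnth t i))%:E)%E.
  exact: eq_measure_integral.
rewrite ge0_integral_pushforward//; first last.
- by move=> t _; rewrite lee_fin; apply: prodr_ge0 => i _; exact: unit_power_ge0.
- exact: measurable_prod_unit_power.
rewrite preimage_setT.
rewrite fubini_tonelli1; first last.
- by move=> t; rewrite /= lee_fin; apply: prodr_ge0 => i _; exact: unit_power_ge0.
- by apply: measurableT_comp => //; exact: measurable_prod_unit_power.
transitivity (\int[leb]_x ((unit_power (b ord0) x)%:E * (\prod_i (b (lift ord0 i)).+1%:R^-1)%:E))%E.
  apply: eq_integral => x _; rewrite /fubini_F -IH.
  rewrite -ge0_integralZl_EFin//; first last.
  - exact: unit_power_ge0.
  - exact: measurable_prod_unit_power.
  - by move=> t _; rewrite lee_fin; apply: prodr_ge0 => i _; exact: unit_power_ge0.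
  apply: eq_integral => t _; rewrite /= -EFinM big_ord_recl; congr (_ * _)%:E.
  by apply: eq_bigr => i _; rewrite tnthS.
rewrite ge0_integralZr//.
- by rewrite integral_unit_power -EFinM big_ord_recl.
- by apply/measurable_EFinP; exact: measurable_unit_power.
- by move=> x _; rewrite lee_fin unit_power_ge0.
- by rewrite lee_fin; apply: prodr_ge0 => i _; rewrite invr_ge0.
Qed.

(** A j-th power of a sum of k terms is expanded over the maps [phi] rather than over multi-indices,
    which avoids multinomial coefficients. The fibre over i is the exponent of the i-th variable. *)
Definition fiber_card k j (phi : {ffun 'I_j -> 'I_k}) (i : 'I_k) : nat :=
  #|[pred m | phi m == i]|.

Lemma prod_fiber (A : comNzRingType) k j (phi : {ffun 'I_j -> 'I_k}) (x : 'I_k -> A) :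
  \prod_m x (phi m) = \prod_i x i ^+ fiber_card phi i.
Proof.
rewrite (partition_big phi xpredT)//=; apply: eq_bigr => i _.
rewrite (eq_bigr (fun=> x i)) => [|m /eqP -> //].
by rewrite prodr_const.
Qed.

Lemma sum_fiber_card k j (phi : {ffun 'I_j -> 'I_k}) : \sum_i fiber_card phi i = j.
Proof.
rewrite -[RHS](card_ord j) -sum1_card (partition_big phi xpredT)//=.
by apply: eq_bigr => i _; rewrite /fiber_card -sum1_card.
Qed.

Lemma exprn_sum_fiber (A : comNzRingType) k j (x : 'I_k -> A) :
  (\sum_i x i) ^+ j = \sum_(phi : {ffun 'I_j -> 'I_k}) \prod_i x i ^+ fiber_card phi i.
Proof.
under [RHS]eq_bigr => phi _ do rewrite -(prod_fiber phi x).
rewrite -(bigA_distr_bigA (fun _ i => x i)).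
by rewrite prodr_const card_ord.
Qed.

(** The index set is that of the expansion of (log <x>)^j, so leading coefficients match term by
    term. *)
Lemma V_E k j : V_ k j =
  \sum_(phi : {ffun 'I_j -> 'I_k}) \prod_i (fiber_card phi i).+1%:R^-1 :> R.
Proof.
rewrite /V_ /Rintegral integral_mkcond.
rewrite (_ : (_ \_ _) = fun t : k.-tuple (measurableTypeR R) =>
  (\sum_(phi : {ffun 'I_j -> 'I_k})
    (\prod_i unit_power (fiber_card phi i) (tnth t i))%:E)%E); last first.
  apply/funext => t; rewrite patchE sumEFin.
  case: (boolP (t \in _)) => [|/negP]; rewrite inE /unit_cube /= => ht.
    congr (_%:E); rewrite exprn_sum_fiber; apply: eq_bigr => phi _.
    apply: eq_bigr => i _; rewrite /unit_power indicE mem_set ?mulr1//.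
    by rewrite /= in_itv /=; exact: ht.
  have [i hi] : exists i, ~ (0 <= tnth t i <= 1) by apply/existsNP.
  rewrite big1 => [//|phi _]; rewrite (bigD1 i)//= /unit_power indicE memNset ?mulr0 ?mul0r//.
rewrite ge0_integral_sum//.
- under eq_bigr do rewrite integral_prod_unit_power.
  by rewrite sumEFin.
- by move=> phi; exact: measurable_prod_unit_power.
- by move=> phi t _; rewrite lee_fin; apply: prodr_ge0 => i _; exact: unit_power_ge0.
Qed.

Lemma V_gt0 k j : (0 < k)%N -> 0 < V_ k j :> R.
Proof.
move=> k0; rewrite V_E (bigD1 [ffun=> Ordinal k0])//=.
rewrite ltr_pwDl//; first by apply: prodr_gt0 => i _; rewrite invr_gt0.
by apply: sumr_ge0 => phi _; apply: prodr_ge0 => i _; rewrite invr_ge0.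
Qed.

End cube_moments.

(** * Multidimensional Abel summation *)

Section finite_sums.
Context {R : realType} {k : nat}.

(** Both sides are the sum over the box of side N, which [box_sumE] expands over either index
    type. *)
Lemma ffun_sum_widen (F : ('I_k -> nat) -> R) N M : (N <= M)%N ->
  (forall n i, (N <= n i)%N -> F n = 0) ->
  \sum_(a : {ffun 'I_k -> 'I_M}) F (fun i => a i : nat) =
  \sum_(a : {ffun 'I_k -> 'I_N}) F (fun i => a i : nat).
Proof.
move=> NM F0; pose X : k.-tuple R := [tuple N%:R | _ < k].
have Fv N' (a : {ffun 'I_k -> 'I_N'}) :
    F (fun i => (val (tnth (vec (fun i => a i : nat)) i)).-1) = F (fun i => a i : nat).
  by congr F; apply/funext => i; rewrite tnth_vec.
have XN' N' : (N <= N')%N -> forall i, tnth X i < N'.+1%:R.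
  by move=> NN' i; rewrite tnth_mktuple ltr_nat ltnS.
have e1 := box_sumE (fun x => F (fun i => (val (tnth x i)).-1)) (XN' N (leqnn N)).
have e2 := box_sumE (fun x => F (fun i => (val (tnth x i)).-1)) (XN' M NM).
rewrite e1 in e2; transitivity (\sum_(a : {ffun 'I_k -> 'I_M} | [forall i, (a i).+1%:R <= tnth X i])
    F (fun i => (val (tnth (vec (fun i => a i : nat)) i)).-1)).
  rewrite [RHS]big_mkcond; apply: eq_bigr => a _; rewrite Fv; case: ifPn => //.
  rewrite negb_forall => /existsP[i]; rewrite tnth_mktuple ler_nat -leqNgt => ai.
  exact: F0 ai.
rewrite -e2; apply: eq_big => [a|a _]; last exact: Fv.
by apply/forallP => i; rewrite tnth_mktuple ler_nat.
Qed.

(** Index vectors are grouped by their coordinates in [I]. The factor that tests n_i = 0 outside [I]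
    selects one representative per group; it needs N > 0. *)
Lemma ffun_sum_local (g : ('I_k -> nat) -> R) (I : {set 'I_k}) (a : 'I_k -> nat -> R) N :
  (0 < N)%N -> (forall n n', (forall i, i \in I -> n i = n' i) -> g n = g n') ->
  \sum_(n : {ffun 'I_k -> 'I_N}) g (fun i => n i : nat) * \prod_i a i (n i) =
  (\prod_(i | i \notin I) \sum_(m < N) a i m) *
  \sum_(n : {ffun 'I_k -> 'I_N}) g (fun i => n i : nat) *
    \prod_i (if i \in I then a i (n i) else (n i == 0%N :> nat)%:R).
Proof.
case: N => // N _ gI.
pose proj (n : {ffun 'I_k -> 'I_N.+1}) : {ffun 'I_k -> 'I_N.+1} :=
  [ffun i => if i \in I then n i else ord0].
rewrite (partition_big proj xpredT)//= mulr_sumr; apply: eq_bigr => m _.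
pose Q i : pred 'I_N.+1 := fun x => (if i \in I then x else ord0) == m i.
have projQ n : (proj n == m) = (n \in family Q).
  apply/eqP/familyP => [nm i|h]; first by rewrite unfold_in /Q -nm ffunE.
  by apply/ffunP => i; rewrite ffunE; apply/eqP; have := h i; rewrite unfold_in.
rewrite (eq_bigr (fun n : {ffun 'I_k -> 'I_N.+1} =>
    g (fun i => m i : nat) * \prod_i a i (n i))) => [|n /eqP nm]; last first.
  by congr (_ * _); apply: gI => i iI; rewrite -nm ffunE iI.
rewrite -mulr_sumr mulrCA; congr (_ * _).
rewrite (eq_bigl _ _ projQ) -(bigA_distr_big_dep Q (fun i x => a i x)).
rewrite [RHS]mulrC (bigID (mem I)) [in RHS](bigID (mem I)) /= -mulrA; congr (_ * _).
  apply: eq_bigr => i iI; rewrite iI (big_pred1 (m i))// => x.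
  by rewrite /Q iI.
rewrite -big_split /=; apply: eq_bigr => i /negbTE iI; rewrite iI /Q iI.
have [mi|mi] := eqVneq (m i) ord0; first by rewrite mi /= mul1r.
rewrite big_pred0_eq (_ : (m i == 0%N :> nat) = false) ?mul0r//.
exact/negbTE.
Qed.

End finite_sums.

(** * Expansion of the weighted sums over the family *)

Section asymptotics.
Context {R : realType} {k : nat}.
Hypothesis k_gt0 : (0 < k)%N.
Variables (alpha c D nu delta : R) (H : set (k.-tuple posint -> R)).
Variable cH : (k.-tuple posint -> R) -> R.
Hypothesis hH : is_family alpha c D nu delta H cH.
Implicit Types (h : k.-tuple posint -> R) (b : 'I_k -> nat) (I : {set 'I_k}).

(** The contribution of one monomial in the log x_i. *)
Definition weighted_sum b h N : R := \sum_(a : {ffun 'I_k -> 'I_N})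
  (\prod_i weight alpha (b i) (a i)) * h (vec (fun i => a i : nat)).

Lemma prodN_powR (I : finType) (f : I -> R) (r : R) : (forall i, 0 < f i) ->
  \prod_i f i `^ (- r) = (\prod_i f i `^ r)^-1.
Proof. by move=> f0; rewrite -prodfV; apply: eq_bigr => i _; rewrite powRN. Qed.

Lemma log_sumE j h (X : R) : 1 < X -> log_sum alpha j h X =
  \sum_(phi : {ffun 'I_j -> 'I_k}) weighted_sum (fiber_card phi) h (Num.truncn X).
Proof.
move=> X1; rewrite /log_sum.
have X0 : 0 <= X by rewrite ltW// (lt_trans ltr01).
have /andP[NX XN] := Num.Theory.truncn_itv X0; set N := Num.truncn X in NX XN *.
rewrite (@box_sumE _ _ _ N); last by move=> i; rewrite tnth_mktuple.
rewrite (eq_bigl xpredT); last first.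
  move=> a; apply/forallP => i; rewrite tnth_mktuple (le_trans _ NX)// ler_nat.
  exact: ltn_ord.
rewrite /weighted_sum exchange_big /=; apply: eq_bigr => a _.
rewrite -mulr_suml; congr (_ * _).
have a0 i : (0 : R) <= tnth (toR (vec (fun i => a i : nat))) i by rewrite tnth_toR_vec.
rewrite vprod_powR// /vprod.
under [X in ln X]eq_bigr do rewrite tnth_toR_vec.
have -> : ln (\prod_(i < k) ((a i).+1%:R : R)) = \sum_(i < k) ln (a i).+1%:R.
  suff [] : ln (\prod_(i < k) ((a i).+1%:R : R)) = \sum_(i < k) ln (a i).+1%:R /\
      0 < \prod_(i < k) ((a i).+1%:R : R) by [].
  elim: (index_enum _) => [|i l [IH1 IH2]]; first by rewrite !big_nil ln1.
  by rewrite !big_cons lnM ?posrE// IH1 mulr_gt0.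
rewrite exprn_sum_fiber mulr_suml; apply: eq_bigr => phi _.
rewrite -prodfV -big_split /=; apply: eq_bigr => i _.
by rewrite /weight tnth_toR_vec powRN mulrC.
Qed.

(** Every weight is replaced by its sum over n_i >= a_i. Exchanging the sums leaves the box sum of h
    up to n, and the factors (n_i + 1)^(-alpha) normalise it to a mean. *)
Lemma weighted_sum_abel b h N : weighted_sum b h N =
  \sum_(n : {ffun 'I_k -> 'I_N}) mean alpha h (fun i => n i : nat) *
    \prod_i abel_coef alpha (b i) N (n i).
Proof.
rewrite /weighted_sum.
under eq_bigr => a _.
  under eq_bigr => i _ do rewrite -(sum_abel_coef _ _ (ltn_ord (a i))).
  rewrite (bigA_distr_big_dep (fun i (n : 'I_N) => (a i <= n)%N)
    (fun i (n : 'I_N) => n.+1%:R `^ (- alpha) * abel_coef alpha (b i) N n)) mulr_suml.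
  over.
rewrite (exchange_big_dep xpredT)//=; apply: eq_bigr => n _.
rewrite /mean /box_sum (@box_sumE _ _ _ N); last first.
  by move=> i; rewrite tnth_toR_vec ltr_nat ltnS.
rewrite big_split /= prodN_powR//.
rewrite -mulr_sumr [LHS]mulrC mulrA; congr (_ * _ * _).
apply: eq_bigl => a; apply/familyP/forallP => an i; have := an i;
  by rewrite unfold_in tnth_toR_vec ler_nat ltnS.
Qed.

Definition component_sum b h I N : R := \sum_(n : {ffun 'I_k -> 'I_N})
  component alpha h I (fun i => n i : nat) * \prod_i abel_coef alpha (b i) N (n i).

Lemma weighted_sum_components b h N : H h ->
  weighted_sum b h N = \sum_I component_sum b h I N.
Proof.
move=> Hh; rewrite weighted_sum_abel exchange_big /=; apply: eq_bigr => n _.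
by rewrite -mulr_suml (sum_component k_gt0 hH).
Qed.

(** Outside [I] the coefficient pins the index to 0, so a sum over the coordinates in [I] can be
    indexed by full vectors. *)
Definition local_coef b I N i m : R :=
  if i \in I then abel_coef alpha (b i) N m else (m == 0%N)%:R.

Definition local_sum b h I N : R := \sum_(n : {ffun 'I_k -> 'I_N})
  component alpha h I (fun i => n i : nat) * \prod_i local_coef b I N i (n i).

Lemma component_sumE b h I N : (0 < N)%N -> component_sum b h I N =
  (\prod_(i | i \notin I) \sum_(m < N) abel_coef alpha (b i) N m) * local_sum b h I N.
Proof.
move=> N0; rewrite /component_sum (@ffun_sum_local _ _ (component alpha h I) I
  (fun i m => abel_coef alpha (b i) N m) N N0 (fun n n' => @component_local _ _ alpha h I n n')).
by [].
Qed.

Lemma local_sum_widen b h I N M : (0 < N <= M)%N -> local_sum b h I N =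
  \sum_(n : {ffun 'I_k -> 'I_M}) component alpha h I (fun i => n i : nat) *
    \prod_i local_coef b I N i (n i).
Proof.
move=> /andP[N0 NM]; apply/esym.
apply: (ffun_sum_widen (F := fun n => component alpha h I n * \prod_i local_coef b I N i (n i)) NM).
move=> n i Nn; rewrite (bigD1 i)//= {1}/local_coef.
case: ifPn => _; first by rewrite abel_coef_ge// mul0r mulr0.
by rewrite eqn0Ngt (leq_trans N0 Nn) mul0r mulr0.
Qed.

(** By [component_bound] and [prodB_norm_le] each summand of the difference is at most C times a
    difference of products. Summation over all vectors makes the factors one-variable sums, and
    [sum_abel_coef_bound] with [prod_perturb_le] gives the rate. *)
Lemma local_sum_cauchy b I : exists theta C : R, [/\ 0 < theta, 0 <= C &
  forall h N M, H h -> (0 < N <= M)%N ->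
    `|local_sum b h I N - local_sum b h I M| <= C * N%:R `^ (- theta)].
Proof.
have [theta t0 [C C0 hC]] := component_bound k_gt0 hH.
have a0 := fam_alpha_gt0 hH.
have exK (i : 'I_k) : exists K : R, 0 <= K /\
  ((forall N M, (0 < N <= M)%N ->
    \sum_(n < M) n.+1%:R `^ (- theta) * `|abel_coef alpha (b i) N n| <= K) /\
  (forall N M, (0 < N <= M)%N ->
    \sum_(n < M) n.+1%:R `^ (- theta) * `|abel_coef alpha (b i) M n - abel_coef alpha (b i) N n|
      <= K * N%:R `^ (- (theta / 2)))).
  by have [x] := sum_abel_coef_bound a0 (b i) t0; exists x.
have [K hK] := choice exK.
have K0 i : 0 <= K i by have [] := hK i.
(* The added 1 covers indices outside [I], where the local coefficients sum to 1. *)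
exists (theta / 2), (C * \prod_i (K i + 1 + (K i + 1))); split.
- by rewrite divr_gt0.
- by rewrite mulr_ge0// prodr_ge0// => i _; rewrite !addr_ge0.
move=> h N M Hh NM; have /andP[N0 _] := NM.
set e := N%:R `^ _.
have e01 : 0 <= e <= 1 by rewrite powR_ge0 natr_powRN_le1// divr_ge0// ltW.
have M0 : (0 < M <= M)%N by rewrite leqnn andbT; case/andP: (NM) => N0' NM'; exact: leq_trans NM'.
rewrite (local_sum_widen b h I NM) (local_sum_widen b h I M0) -sumrB.
pose s i m : R := if i \in I then m.+1%:R `^ (- theta) else 1.
have s0 i m : 0 <= s i m by rewrite /s; case: ifP => // _; exact: powR_ge0.
pose beta i m := s i m * `|local_coef b I N i m|.
pose d i m := s i m * `|local_coef b I M i m - local_coef b I N i m|.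
have step (n : {ffun 'I_k -> 'I_M}) :
    `|component alpha h I (fun i => n i : nat) * \prod_i local_coef b I N i (n i) -
      component alpha h I (fun i => n i : nat) * \prod_i local_coef b I M i (n i)| <=
    C * (\prod_i (beta i (n i) + d i (n i)) - \prod_i beta i (n i)).
  rewrite -mulrBr normrM distrC.
  have hs : \prod_(i in I) (n i).+1%:R `^ (- theta) = \prod_i s i (n i).
    by rewrite big_mkcond.
  apply: le_trans (ler_wpM2r (normr_ge0 _) (hC h I _ Hh)) _.
  rewrite hs -mulrA ler_wpM2l//.
  rewrite -[X in X * _]ger0_norm ?prodr_ge0// -normrM mulrBr -!big_split /=.
  apply: prodB_norm_le => i; first by rewrite normrM ger0_norm.
  by rewrite -mulrBr normrM ger0_norm.
apply: le_trans (ler_norm_sum _ _ _) _.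
apply: le_trans (ler_sum _ (fun n _ => step n)) _.
rewrite -mulr_sumr -mulrA ler_wpM2l// sumrB.
rewrite -(bigA_distr_bigA (fun i (m : 'I_M) => beta i m + d i m)).
rewrite -(bigA_distr_bigA (fun i (m : 'I_M) => beta i m)).
under [X in X - _]eq_bigr do rewrite big_split /=.
have b0 i m : 0 <= beta i m by rewrite mulr_ge0.
have B0 i : 0 <= \sum_(m < M) beta i m by apply: sumr_ge0.
have BK i : \sum_(m < M) beta i m <= K i + 1.
  rewrite /beta /s /local_coef /=; case: (boolP (i \in I)) => iI.
    by have [_ [h1 _]] := hK i; rewrite (le_trans (h1 N M NM))// lerDl.
  rewrite (bigD1 (Ordinal (leq_trans N0 (andP NM).2)))//= big1.
    by rewrite mul1r normr1 addr0 lerDr.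
  move=> m /eqP m0; case: eqP => [me|_]; last by rewrite normr0 mulr0.
  by case: m0; exact: val_inj.
have DK i : \sum_(m < M) d i m <= e * (K i + 1).
  have /andP[e0 _] := e01.
  rewrite /d /s /local_coef /=; case: (boolP (i \in I)) => iI.
    have [_ [_ h2]] := hK i; rewrite (le_trans (h2 N M NM))// mulrC.
    by rewrite ler_wpM2l// lerDl.
  by rewrite big1 => [|m _]; [rewrite mulr_ge0// addr_ge0|rewrite subrr normr0 mulr0].
have D0 i : 0 <= \sum_(m < M) d i m by apply: sumr_ge0 => m _; rewrite mulr_ge0.
apply: (@le_trans _ _ (\prod_i (\sum_(m < M) beta i m + e * (K i + 1)) -
  \prod_i \sum_(m < M) beta i m)).
  rewrite lerD2r; apply: ler_prod => i _.
  by rewrite addr_ge0//= lerD2l.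
apply: le_trans (prod_perturb_le _ e01 B0 (fun i => addr_ge0 (K0 i) ler01)) _.
have /andP[e0 _] := e01.
rewrite [leRHS]mulrC ler_wpM2l//; apply: ler_prod => i _.
by rewrite addr_ge0 ?addr_ge0//= lerD2r.
Qed.

(** The Cauchy rate gives the limits. Their bound uniform in h comes from comparison with N = 1,
    where the sum has a single term. *)
Lemma asym_local_sum b I : exists l, asym H 0 l (fun h N => local_sum b h I N).
Proof.
have [theta [C [t0 C0 hC]]] := local_sum_cauchy b I.
have exl h : exists a, H h -> forall N, (0 < N)%N ->
    `|local_sum b h I N - a| <= C * N%:R `^ (- theta).
  have [Hh|nHh] := pselect (H h); last by exists 0.
  have [a ha] := @cauchy_rate _ (local_sum b h I) (fun N => C * N%:R `^ (- theta))
    (fun N M NM => hC h N M Hh NM).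
  by exists a.
have [l hl] := choice exl.
have [theta' t0' [C' C0' hC']] := component_bound k_gt0 hH.
pose P := \prod_i `|local_coef b I 1 i 0|.
exists l; apply: (@asym_limit _ _ _ _ _ (C + C' * P) C theta) => // [h Hh|h N Hh N0]; last exact: hl.
  have := hl h Hh 1%N isT; rewrite powR1 mulr1 => h1.
  rewrite -[l h](subKr (local_sum b h I 1)) (le_trans (ler_normB _ _))//.
  rewrite addrC lerD// /local_sum (bigD1 [ffun=> ord0])//= [X in _ + X]big1 => [|n]; last first.
    by move=> /eqP[]; apply/ffunP => i; rewrite ord1 ffunE.
  rewrite addr0 normrM normr_prod.
  have -> : \prod_(i < k) `|local_coef b I 1 i ([ffun=> ord0] i : 'I_1)| = P.
    by apply: eq_bigr => i _; rewrite ffunE.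
  rewrite ler_wpM2r ?prodr_ge0// (le_trans (hC' _ _ _ Hh))// ler_piMr//.
  by apply: prodr_ile1 => i _; rewrite powR_ge0 ffunE powR1 lexx.
Qed.

Lemma asym_sum_abel_coef (b : nat) : asym H b.+1 (fun=> alpha / b.+1%:R)
  (fun _ N => \sum_(m < N) abel_coef alpha b N m).
Proof.
have [g [C hC]] := sum_abel_coef_asymp (fam_alpha_gt0 hH) b.
pose q := alpha / b.+1%:R.
exists 2^-1; first by rewrite invr_gt0.
exists (`|C| + (`|q| + `|g|)) => [|h _]; first by rewrite !addr_ge0.
have c0 : 0 <= `|C| + (`|q| + `|g|) by rewrite !addr_ge0.
exists (q *: 'X^(b.+1) + g%:P); split.
- rewrite (leq_trans (size_polyD _ _))// geq_max.
  rewrite (leq_trans (size_scale_leq _ _)) ?size_polyXn//=.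
  by rewrite (leq_trans (size_polyC_leq1 _)).
- by rewrite coefD coefZ coefXn coefC eqxx mulr1 addr0.
- move=> i; rewrite coefD coefZ coefXn coefC (le_trans (ler_normD _ _))//.
  apply: (@le_trans _ _ (`|q| + `|g|)); last by rewrite lerDr.
  rewrite lerD//; last by case: ifP; rewrite ?normr0.
  by case: eqP; rewrite ?mulr1// mulr0 normr0.
- move=> N N0; rewrite hornerD hornerZ hornerXn hornerC (le_trans (hC N N0))//.
  by rewrite ler_wpM2r ?powR_ge0// (le_trans (ler_norm _))// lerDl addr_ge0.
Qed.

(** A variable outside I contributes degree b_i + 1 and the variables in I together degree 0. *)
Lemma asym_component_sum b I : asym H (\sum_i (b i).+1)
  (fun h => if I == finset.set0 then cH h * \prod_i (alpha / (b i).+1%:R) else 0)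
  (fun h N => component_sum b h I N).
Proof.
have asP (P : pred 'I_k) : asym H (\sum_(i | P i) (b i).+1)
    (fun h => \prod_(i | P i) (alpha / (b i).+1%:R))
    (fun h N => \prod_(i | P i) \sum_(m < N) abel_coef alpha (b i) N m).
  by apply: (asym_prod (l := fun i _ => alpha / (b i).+1%:R)) => i _; exact: asym_sum_abel_coef.
have [->|I0] := eqVneq I finset.set0.
  have asC : asym H 0 cH (fun h N => cH h).
    apply: (@asym_limit _ _ _ _ _ c 0 1) => // [h Hh|h N _ _].
      have [hc _] := fam_I hH; have /andP[c0 cc] := hc h Hh.
      by rewrite ger0_norm.
    by rewrite subrr normr0 mul0r.
  have := asymM asC (asP xpredT).
  rewrite add0n; apply: asym_ext => // h N Hh N0.
  rewrite /component_sum; under [RHS]eq_bigr do rewrite (component_set0 k_gt0 hH)//.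
  by rewrite -mulr_sumr -(bigA_distr_bigA (fun i (m : 'I_N) => abel_coef alpha (b i) N m)).
have [l asl] := asym_local_sum b I.
have := asymM (asP (fun i => i \notin I)) asl.
rewrite addn0 => /(@asym_widen _ _ _ _ (\sum_i (b i).+1)) h.
apply: (asym_ext _ _ (h _)) => // [h' N Hh N0|]; first by rewrite component_sumE.
(* An element of [I] is absent from the product, so the degree is strictly smaller. *)
have /set0Pn[i iI] := I0.
rewrite [X in (_ < X)%N](bigID (fun i => i \notin I))/= -[X in (X < _)%N]addn0 ltn_add2l.
by rewrite (bigD1 i)/= ?negbK.
Qed.

Lemma asym_log_sum j : asym H (k + j) (fun h => alpha ^+ k * cH h * V_ k j)
  (fun h N => \sum_(phi : {ffun 'I_j -> 'I_k}) weighted_sum (fiber_card phi) h N).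
Proof.
have as1 (phi : {ffun 'I_j -> 'I_k}) : asym H (k + j)
    (fun h => cH h * \prod_i (alpha / (fiber_card phi i).+1%:R))
    (fun h N => weighted_sum (fiber_card phi) h N).
  (* The fibres of [phi] partition its j arguments, hence all monomials give the same degree. *)
  have -> : (k + j = \sum_i (fiber_card phi i).+1)%N.
    under eq_bigr do rewrite -add1n.
    by rewrite big_split /= sum_fiber_card sum1_card card_ord.
  have := asym_sum (P := xpredT) (fun I _ => asym_component_sum (fiber_card phi) I).
  apply: asym_ext => [h Hh|h N Hh N0]; last by rewrite weighted_sum_components.
  by rewrite -big_mkcond /= big_pred1_eq.
have := asym_sum (P := xpredT) (fun phi _ => as1 phi).
apply: asym_ext => // h Hh.
rewrite V_E mulr_sumr; apply: eq_bigr => phi _.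
rewrite big_split /= prodr_const card_ord; ring.
Qed.

End asymptotics.

Theorem theorem2p7 (R : realType) (k : nat) (hk : (0 < k)%N)
    (alpha c D nu delta : R) (H : set (k.-tuple posint -> R))
    (cH : (k.-tuple posint -> R) -> R)
    (hH : is_family alpha c D nu delta H cH) (j : nat) :
  exists2 eta : R, 0 < eta &
  exists C : R, forall h, H h ->
  exists p : {poly R},
    [/\ (size p <= (k + j).+1)%N,
        forall X : R, 1 < X ->
          `| log_sum alpha j h X - p.[ln X] | <= C * X `^ (- eta)
      & cH h <> 0 ->
          size p = (k + j).+1 /\ lead_coef p = alpha ^+ k * cH h * V_ k j].
Proof.
have [eta eta0 [C hC]] := asym_real (asym_log_sum hk hH j).
exists eta => //; exists C => h Hh; have [p [sp pl pX]] := hC h Hh.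
exists p; split=> // [X X1|/eqP cH0]; first by rewrite log_sumE//; exact: pX.
(* A smaller size would make the coefficient in degree k + j zero, but alpha, c_h and V_{k,j} are
   all nonzero. *)
have sE : size p = (k + j).+1.
  apply/eqP; rewrite eqn_leq sp ltnNge; apply/negP => /leq_sizeP /(_ _ (leqnn _)).
  apply/eqP; rewrite pl !mulf_neq0 ?expf_neq0//.
    by rewrite gt_eqF// (fam_alpha_gt0 hH).
  by rewrite gt_eqF// V_gt0.
by split=> //; rewrite lead_coefE sE.
Qed.
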